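(* Let $\mathcal{T}$ be the family of Poncelet triangles inscribed in the non-circular ellipse $\mathcal{E}$ and circumscribing the nested ellipse $\mathcal{E}_c$. For each $P$ on $\mathcal{E}$, the locus $\mathcal{L}_{gP}$ of the isogonal conjugate $gP$ of $P$ with respect to the triangles in $\mathcal{T}$ is line-like (it degenerates to a line minus a point). Over all $P$ on $\mathcal{E}$, the envelope of the line-like $\mathcal{L}_{gP}$ is a conic concentric with $\mathcal{E}_c$ and axis-aligned with $\mathcal{E}$.
   Context: $\mathcal{E}$ is a generic ellipse with semiaxes' lengths $a,b$, given by $(x/a)^2+(y/b)^2=1$. $\mathcal{E}_c$ is an ellipse nested in $\mathcal{E}$ such that the pair admits a Poncelet porism of triangles, and $\mathcal{T}$ is the resulting one-parameter family of triangles inscribed in $\mathcal{E}$ with sides tangent to $\mathcal{E}_c$. The isogonal conjugate $gP$ of a point $P$ with respect to a triangle is the point of concurrence of the cevians of $P$ (lines from each vertex through $P$) reflected about the angle bisectors; if $P$ has barycentric coordinates $[z_1:z_2:z_3]$ and the triangle has sidelengths $l_1,l_2,l_3$, then $gP=[l_1^2/z_1:l_2^2/z_2:l_3^2/z_3]$. With $P=P(t)$ running over $\mathcal{E}$, the envelope of the lines is the curve obtained by eliminating $t$ from the equation of the line and its derivative with respect to $t$. Axis-aligned means having axes parallel to those of the other conic.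
   Formalization: The claim that the envelope is axis-aligned with E fails when E_c is tilted relative to E; it is replaced by: the envelope is axis-aligned with E_c, and it is axis-aligned with E if and only if E_c is. The line minus a point is read in the projective plane. *)

(* Defs.v *)
(* Standard-library real numbers, with Coquelicot for derivatives. *)
From Stdlib Require Import Reals.
From Coquelicot Require Import Coquelicot.
Open Scope R_scope.

Definition point : Type := (R * R)%type.

Definition padd (U V : point) : point := (fst U + fst V, snd U + snd V).
Definition psub (U V : point) : point := (fst U - fst V, snd U - snd V).
Definition pscale (k : R) (U : point) : point := (k * fst U, k * snd U).
Definition dot (U V : point) : R := fst U * fst V + snd U * snd V.
Definition norm2 (U : point) : R := sqrt (dot U U).

Definition collinear (U V W : point) : Prop :=
  (fst V - fst U) * (snd W - snd U) - (snd V - snd U) * (fst W - fst U) = 0.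

(* The curve qxx x^2 + qxy x y + qyy y^2 + qx x + qy y + q1 = 0. *)
Record conic : Type := Conic
  { qxx : R; qxy : R; qyy : R; qx : R; qy : R; q1 : R }.

Definition conic_eval (Q : conic) (X : point) : R :=
  qxx Q * fst X ^ 2 + qxy Q * fst X * snd X + qyy Q * snd X ^ 2
  + qx Q * fst X + qy Q * snd X + q1 Q.

Definition on_conic (Q : conic) (X : point) : Prop := conic_eval Q X = 0.

(* Four times the determinant of the symmetric 3 x 3 matrix of the conic. *)
Definition conic_det (Q : conic) : R :=
  4 * qxx Q * qyy Q * q1 Q + qxy Q * qx Q * qy Q
  - qxx Q * qy Q ^ 2 - qyy Q * qx Q ^ 2 - q1 Q * qxy Q ^ 2.

Definition nondegenerate (Q : conic) : Prop := conic_det Q <> 0.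

(* A definite quadratic part leaves three cases: the empty set, a single point
   and a genuine (real, nondegenerate) ellipse.  Two distinct points select
   the last one.  Circles are included, and the position is arbitrary. *)
Definition is_ellipse (Q : conic) : Prop :=
  0 < 4 * qxx Q * qyy Q - qxy Q ^ 2 /\
  exists X Y : point, X <> Y /\ on_conic Q X /\ on_conic Q Y.

(* Centre of a central conic: the zero of the gradient of its equation. *)
Definition is_center (Q : conic) (X : point) : Prop :=
  4 * qxx Q * qyy Q - qxy Q ^ 2 <> 0 /\
  2 * qxx Q * fst X + qxy Q * snd X + qx Q = 0 /\
  qxy Q * fst X + 2 * qyy Q * snd X + qy Q = 0.

Definition concentric (Q1 Q2 : conic) : Prop :=
  exists X : point, is_center Q1 X /\ is_center Q2 X.

(* The direction D of an axis of Q, as an eigenvector of the symmetric matrix of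
   the quadratic part.  Every direction is an axis direction of a circle. *)
Definition axis_direction (Q : conic) (D : point) : Prop :=
  D <> (0, 0) /\
  exists mu : R,
    qxx Q * fst D + qxy Q / 2 * snd D = mu * fst D /\
    qxy Q / 2 * fst D + qyy Q * snd D = mu * snd D.

(* One common axis direction is enough: the orthogonal direction is then common
   as well. *)
Definition axis_aligned (Q1 Q2 : conic) : Prop :=
  exists D : point, axis_direction Q1 D /\ axis_direction Q2 D.

Definition std_ellipse (a b : R) : conic :=
  Conic (1 / a ^ 2) 0 (1 / b ^ 2) 0 0 (- 1).

Definition nested (Q : conic) (a b : R) : Prop :=
  forall X : point, on_conic Q X -> (fst X / a) ^ 2 + (snd X / b) ^ 2 < 1.

(* For an ellipse Q, the line UV is tangent to Q iff it meets Q exactly once. *)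
Definition line_tangent (Q : conic) (U V : point) : Prop :=
  exists! X : point, collinear U V X /\ on_conic Q X.

Definition poncelet_triangle (E Ec : conic) (V1 V2 V3 : point) : Prop :=
  ~ collinear V1 V2 V3 /\
  on_conic E V1 /\ on_conic E V2 /\ on_conic E V3 /\
  line_tangent Ec V1 V2 /\ line_tangent Ec V2 V3 /\ line_tangent Ec V3 V1.

Definition admits_porism (E Ec : conic) : Prop :=
  forall V1 : point, on_conic E V1 ->
  exists V2 V3 : point, poncelet_triangle E Ec V1 V2 V3.

(* Homogeneous coordinates: a nonzero triple (x, y, w) is a point of the real
   projective plane, at infinity when w = 0, and a triple (l, m, n) with
   (l, m) <> (0, 0) is the affine line l x + m y + n = 0. *)
Definition triple : Type := (R * R * R)%type.

Definition hom (X : point) : triple := (fst X, snd X, 1).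

Definition incident (L X : triple) : Prop :=
  let '(l, m, n) := L in let '(x, y, w) := X in l * x + m * y + n * w = 0.

Definition proportional (X Y : triple) : Prop :=
  let '(x, y, w) := X in let '(x', y', w') := Y in
  exists k : R, k <> 0 /\ x = k * x' /\ y = k * y' /\ w = k * w'.

Definition join (X Y : triple) : triple :=
  let '(x, y, w) := X in let '(x', y', w') := Y in
  (y * w' - w * y', w * x' - x * w', x * y' - y * x').

Definition bisector_direction (V U W : point) : point :=
  padd (pscale (/ norm2 (psub U V)) (psub U V))
       (pscale (/ norm2 (psub W V)) (psub W V)).

(* Mirror image of X in the line through V with direction D. *)
Definition reflect (V D X : point) : point :=
  psub (padd V (pscale (2 * dot (psub X V) D / dot D D) D)) (psub X V).

(* The cevian VP of the triangle VUW, reflected about the bisector at V. *)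
Definition reflected_cevian (V U W P : point) : triple :=
  join (hom V) (hom (reflect V (bisector_direction V U W) P)).

(* G (homogeneous) is the isogonal conjugate of P with respect to V1 V2 V3.  It is
   defined when P lies on no side line; it may be a point at infinity, namely
   when P is on the circumcircle. *)
Definition isogonal_conjugate (V1 V2 V3 P : point) (G : triple) : Prop :=
  ~ collinear V1 V2 P /\ ~ collinear V2 V3 P /\ ~ collinear V3 V1 P /\
  G <> (0, 0, 0) /\
  incident (reflected_cevian V1 V2 V3 P) G /\
  incident (reflected_cevian V2 V3 V1 P) G /\
  incident (reflected_cevian V3 V1 V2 P) G.

(* For P on E, the only triangle of the family which contributes nothing is the
   one with a vertex at P. *)
Definition locus_gP (E Ec : conic) (P : point) (G : triple) : Prop :=
  exists V1 V2 V3 : point,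
    poncelet_triangle E Ec V1 V2 V3 /\ isogonal_conjugate V1 V2 V3 P G.

(* S is the line L minus exactly one of its projective points.  The removed point
   can be the point at infinity of L, and in all other cases the point at infinity
   of L belongs to S. *)
Definition punctured_line (L : triple) (S : triple -> Prop) : Prop :=
  (let '(l, m, _) := L in (l, m) <> (0, 0)) /\
  exists X0 : triple,
    X0 <> (0, 0, 0) /\ incident L X0 /\
    forall X : triple, X <> (0, 0, 0) ->
      (S X <-> incident L X /\ ~ proportional X X0).

Definition line_like (S : triple -> Prop) : Prop :=
  exists L : triple, punctured_line L S.

(* [line_at t L] means that L is the line of parameter t.  The envelope does not
   depend on the differentiable equation chosen for the family. *)
Definition is_envelope (line_at : R -> triple -> Prop) (S : point -> Prop)
    : Prop :=
  exists l m n : R -> R,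
    (forall t : R, ex_derive l t /\ ex_derive m t /\ ex_derive n t) /\
    (forall t : R, line_at t (l t, m t, n t)) /\
    forall X : point,
      S X <->
      exists t : R,
        l t * fst X + m t * snd X + n t = 0 /\
        Derive l t * fst X + Derive m t * snd X + Derive n t = 0.

Definition ellipse_point (a b t : R) : point := (a * cos t, b * sin t).

(* Main.v *)
Require Import Defs.
From Stdlib Require Import Reals Lra Psatz.
From Coquelicot Require Import Coquelicot.
Open Scope R_scope.

(** Points of the plane are read as complex numbers, and the affine map
    [squash] carries the outer ellipse to the unit circle.  Let [f], [g] be the
    foci of the squashed caustic, [al = f + g] and [be = f g].

    The inscribed triangles that circumscribe the caustic are the fibres of a
    Blaschke product: with product of vertices [la], the vertices are the three
    roots of [x (x^2 - al x + be) = la (1 - conj al x + conj be x^2)].  Hence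
    the sum of the vertices is [al + conj be la], which is affine in [la]
    ([poncelet_blaschke]), and every unit [la] occurs
    ([poncelet_of_product]).

    For [P = p] on the circle and a triangle of product [la], the squashed
    isogonal conjugate is the quotient
    [(p - al + conj ga la) / (p la - 1)], where [ga = 2 k - be] and
    [k = (a^2 + b^2) / (a^2 - b^2)] ([isogonal_conjugate_gP]).  This is a
    Moebius function of [la] whose pole [conj p] is on the unit circle, so it
    maps the circle onto a projective line.  Exactly one value of [la] does not
    contribute: the one whose triangle has [p] as a vertex
    ([locus_punctured]).

    The line is [Re (p W(G)) = w(G)] with [W] complex valued, [w] real valued,
    both affine in [G] and independent of [p].  As [p] turns on the unit circle
    the envelope is [|W|^2 = w^2], a conic ([is_envelope_conic]) with centre
    [al / 2], the centre of the caustic.  The condition for the Poncelet closure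
    turns its quadratic part into a combination of the quadratic part of the
    caustic and of [x^2 + y^2] ([envelope_pencil]), so the two conics have the
    same axis directions.  It is nondegenerate because the Moebius function is
    never constant ([gP_dir_neq_0], [env_disc_neq_0]). *)

(** * Complex numbers of modulus one *)

Definition on_unit (u : C) : Prop := (u * Cconj u = 1)%C.

Lemma C_eq (u v : C) : fst u = fst v -> snd u = snd v -> u = v.
Proof. destruct u, v; simpl; intros -> ->; reflexivity. Qed.

Lemma on_unit_sqr (u : C) : on_unit u <-> fst u ^ 2 + snd u ^ 2 = 1.
Proof.
  unfold on_unit; split; intros H.
  - apply (f_equal fst) in H; simpl in H; lra.
  - apply C_eq; simpl; lra.
Qed.

Lemma unit_neq_0 (u : C) : on_unit u -> u <> 0%C.
Proof. intros H ->; apply on_unit_sqr in H; simpl in H; lra. Qed.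

Lemma unit_conj (u : C) : on_unit u -> Cconj u = (/ u)%C.
Proof.
  intros H; pose proof (unit_neq_0 u H).
  replace (Cconj u) with (/ u * (u * Cconj u))%C by (field; assumption).
  rewrite H; ring.
Qed.

Lemma unit_mult (u v : C) : on_unit u -> on_unit v -> on_unit (u * v).
Proof.
  unfold on_unit; intros Hu Hv; rewrite Cmult_conj.
  replace (u * v * (Cconj u * Cconj v))%C
    with ((u * Cconj u) * (v * Cconj v))%C by ring.
  rewrite Hu, Hv; ring.
Qed.

Lemma unit_Cconj (u : C) : on_unit u -> on_unit (Cconj u).
Proof. unfold on_unit; rewrite Cconj_conj, Cmult_comm; trivial. Qed.

Lemma unit_cis (t : R) : on_unit (cos t, sin t).
Proof.
  apply on_unit_sqr; simpl; pose proof (sin2_cos2 t); unfold Rsqr in *; lra.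
Qed.

Lemma unit_angle (u : C) : on_unit u -> exists t : R, u = (cos t, sin t).
Proof.
  intros H; apply on_unit_sqr in H.
  assert (Hx : -1 <= fst u <= 1) by nra.
  assert (Hs : sin (acos (fst u)) = Rabs (snd u)).
  { rewrite sin_acos by exact Hx.
    replace (1 - (fst u)²) with ((snd u)²) by (unfold Rsqr; lra).
    apply sqrt_Rsqr_abs. }
  destruct (Rle_dec 0 (snd u)) as [Hy | Hy].
  - exists (acos (fst u)); apply C_eq; simpl.
    + rewrite cos_acos; auto.
    + rewrite Hs, Rabs_pos_eq; auto.
  - exists (- acos (fst u)); apply C_eq; simpl.
    + rewrite cos_neg, cos_acos; auto.
    + rewrite sin_neg, Hs, Rabs_left; lra.
Qed.

Lemma unit_sqrt (u : C) : on_unit u -> exists r : C, on_unit r /\ (r * r = u)%C.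
Proof.
  intros H; destruct (unit_angle u H) as [t ->].
  exists (cos (t / 2), sin (t / 2)); split; [apply unit_cis|].
  replace t with (2 * (t / 2)) at 5 6 by field.
  apply C_eq; simpl; [rewrite cos_2a | rewrite sin_2a]; ring.
Qed.

Lemma C_mult_eq_0 (u v : C) : (u * v = 0)%C -> u = 0%C \/ v = 0%C.
Proof.
  intros H.
  destruct (Ceq_dec u 0) as [|Hu]; [left; assumption|].
  destruct (Ceq_dec v 0) as [|Hv]; [right; assumption|].
  exfalso; exact (Cmult_neq_0 u v Hu Hv H).
Qed.

Lemma C_sub_neq_0 (u v : C) : u <> v -> (u - v)%C <> 0%C.
Proof. intros H E; apply H, Ceq_minus; exact E. Qed.

Lemma Ci2 : (Ci * Ci = - 1)%C.
Proof. apply C_eq; simpl; ring. Qed.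

Lemma C_inv_neq_0 (u : C) : u <> 0%C -> (/ u)%C <> 0%C.
Proof.
  intros Hu E; apply C1_nz; rewrite <- (Cinv_r u Hu), E; ring.
Qed.

Lemma C2_neq_0 : RtoC 2 <> 0%C.
Proof. intros K; apply (f_equal fst) in K; simpl in K; lra. Qed.

Lemma Cconj_R (x : R) : Cconj x = x.
Proof. apply C_eq; simpl; ring. Qed.

Ltac push_conj H :=
  repeat first [rewrite Cplus_conj in H | rewrite Cminus_conj in H
    | rewrite Cmult_conj in H | rewrite Cconj_conj in H | rewrite Cconj_R in H].

(** * Tangent lines and the dual conic *)

(** The [adj] entries are four times those of the adjugate of the symmetric
    matrix of the conic, so [dual_form] is the equation of the dual conic. *)
Definition adj11 (Q : conic) : R := 4 * qyy Q * q1 Q - qy Q ^ 2.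
Definition adj22 (Q : conic) : R := 4 * qxx Q * q1 Q - qx Q ^ 2.
Definition adj33 (Q : conic) : R := 4 * qxx Q * qyy Q - qxy Q ^ 2.
Definition adj12 (Q : conic) : R := qx Q * qy Q - 2 * qxy Q * q1 Q.
Definition adj13 (Q : conic) : R := qxy Q * qy Q - 2 * qyy Q * qx Q.
Definition adj23 (Q : conic) : R := qxy Q * qx Q - 2 * qxx Q * qy Q.

Definition dual_form (Q : conic) (l m n : R) : R :=
  adj11 Q * l ^ 2 + adj22 Q * m ^ 2 + adj33 Q * n ^ 2
  + 2 * adj12 Q * l * m + 2 * adj13 Q * l * n + 2 * adj23 Q * m * n.

Definition quad_part (Q : conic) (D : point) : R :=
  qxx Q * fst D ^ 2 + qxy Q * fst D * snd D + qyy Q * snd D ^ 2.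

Definition polar_part (Q : conic) (U D : point) : R :=
  (2 * qxx Q * fst U + qxy Q * snd U + qx Q) * fst D
  + (qxy Q * fst U + 2 * qyy Q * snd U + qy Q) * snd D.

Definition along (U D : point) (s : R) : point := padd U (pscale s D).

Lemma conic_eval_along Q U D s :
  conic_eval Q (along U D s)
  = quad_part Q D * s ^ 2 + polar_part Q U D * s + conic_eval Q U.
Proof. unfold conic_eval, quad_part, polar_part, along; simpl; ring. Qed.

(** The discriminant of the conic along a line depends on the line only, and it
    is the dual form up to sign: this turns tangency into an equation in line
    coordinates. *)
Lemma discriminant_dual Q U D :
  polar_part Q U D ^ 2 - 4 * quad_part Q D * conic_eval Q U
  = - dual_form Q (- snd D) (fst D) (fst U * snd D - snd U * fst D).
Proof.
  unfold polar_part, quad_part, conic_eval, dual_form, adj11, adj22, adj33, adj12, adj13, adj23.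
  ring.
Qed.

Lemma quad_part_neq_0 Q D : 0 < adj33 Q -> D <> (0, 0) -> quad_part Q D <> 0.
Proof.
  unfold adj33, quad_part; destruct D as [x y]; cbn [fst snd]; intros H HD E.
  assert (Hy : y = 0).
  { assert ((2 * qxx Q * x + qxy Q * y) ^ 2
            + (4 * qxx Q * qyy Q - qxy Q ^ 2) * y ^ 2 = 0) as K.
    { transitivity (4 * qxx Q * (qxx Q * x ^ 2 + qxy Q * x * y + qyy Q * y ^ 2));
        [ring | rewrite E; ring]. }
    pose proof (pow2_ge_0 (2 * qxx Q * x + qxy Q * y)).
    destruct (Req_dec y 0) as [|Hy]; [assumption|].
    assert (0 < y ^ 2) by (apply pow2_gt_0; exact Hy).
    nra. }
  subst y.
  assert (qxx Q <> 0) by (intros K; rewrite K in H; nra).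
  assert (qxx Q * x ^ 2 = 0) as K by nra.
  apply HD; f_equal.
  apply Rmult_integral in K as [K | K]; [contradiction | nra].
Qed.

Lemma dual_form_tangent Q U V :
  0 < adj33 Q -> U <> V -> line_tangent Q U V ->
  dual_form Q (snd U - snd V) (fst V - fst U)
    (fst U * snd V - snd U * fst V) = 0.
Proof.
  intros HQ HUV (X & (HX & HXQ) & Huniq).
  set (D := psub V U).
  assert (HD : D <> (0, 0)).
  { intros E; apply HUV; injection E as E1 E2.
    destruct U, V; simpl in *; f_equal; lra. }
  pose proof (quad_part_neq_0 Q D HQ HD) as HA.
  assert (Hs : exists s, X = along U D s).
  { unfold collinear in HX; unfold along, D, padd, pscale, psub; simpl.
    destruct (Req_dec (fst V - fst U) 0) as [E | E].
    - assert (snd V - snd U <> 0).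
      { intros E'; apply HD; unfold D, psub; f_equal; assumption. }
      exists ((snd X - snd U) / (snd V - snd U)).
      rewrite E in HX |- *.
      apply C_eq; simpl; [|field; assumption].
      assert ((snd V - snd U) * (fst X - fst U) = 0) as K by lra.
      apply Rmult_integral in K as [K | K]; [contradiction | lra].
    - exists ((fst X - fst U) / (fst V - fst U)).
      apply C_eq; simpl; [field; assumption|].
      apply (Rmult_eq_reg_l (fst V - fst U)); [|assumption].
      field_simplify; [|assumption]; lra. }
  destruct Hs as [s Hs].
  (* By Vieta this is the other root along the line; uniqueness forces a double
     root. *)
  pose (s' := - polar_part Q U D / quad_part Q D - s).
  assert (E : X = along U D s').
  { apply Huniq; split.
    - unfold collinear, along, D; simpl; ring.
    - red; red in HXQ; rewrite Hs in HXQ; rewrite conic_eval_along in HXQ |- *.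
      rewrite <- HXQ; unfold s'; field; assumption. }
  assert (Ess : s' = s).
  { rewrite Hs in E; unfold along, padd, pscale in E.
    pose proof (f_equal fst E) as E1; pose proof (f_equal snd E) as E2.
    cbn [fst snd] in E1, E2; clear E; clearbody D.
    destruct (Req_dec (fst D) 0) as [K | K].
    - assert (K' : snd D <> 0)
        by (intros K'; apply HD; apply C_eq; assumption).
      apply (Rmult_eq_reg_r (snd D)); [lra | assumption].
    - apply (Rmult_eq_reg_r (fst D)); [lra | assumption]. }
  assert (EB : polar_part Q U D = - 2 * s * quad_part Q D).
  { replace (polar_part Q U D) with (- (s' + s) * quad_part Q D)
      by (unfold s'; field; assumption).
    rewrite Ess; ring. }
  red in HXQ; rewrite Hs, conic_eval_along in HXQ.
  pose proof (discriminant_dual Q U D) as K.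
  replace (fst U * snd D - snd U * fst D)
    with (fst U * snd V - snd U * fst V) in K by (unfold D; simpl; ring).
  replace (- snd D) with (snd U - snd V) in K by (unfold D; simpl; ring).
  replace (fst D) with (fst V - fst U) in K by (unfold D; simpl; ring).
  assert (Ec : conic_eval Q U = quad_part Q D * s ^ 2) by (rewrite EB in HXQ; lra).
  rewrite EB, Ec in K; ring_simplify in K.
  apply Ropp_eq_reg; rewrite Ropp_0, <- K; ring.
Qed.

Lemma dual_form_meets Q U D :
  0 < adj33 Q -> D <> (0, 0) ->
  dual_form Q (- snd D) (fst D) (fst U * snd D - snd U * fst D) = 0 ->
  exists s : R, on_conic Q (along U D s).
Proof.
  intros HQ HD H.
  pose proof (quad_part_neq_0 Q D HQ HD) as HA.
  exists (- polar_part Q U D / (2 * quad_part Q D)).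
  red; rewrite conic_eval_along.
  apply (Rmult_eq_reg_l (4 * quad_part Q D)); [|lra].
  rewrite Rmult_0_r.
  transitivity (- (polar_part Q U D ^ 2 - 4 * quad_part Q D * conic_eval Q U)).
  - field; assumption.
  - rewrite discriminant_dual, H; ring.
Qed.

(** * Chords of the unit circle that touch the caustic *)

Definition stretch (a b : R) (u : C) : point := (a * fst u, b * snd u).
Definition squash (a b : R) (X : point) : C := (fst X / a, snd X / b).

Lemma stretch_squash a b X : a <> 0 -> b <> 0 -> stretch a b (squash a b X) = X.
Proof. intros; apply C_eq; simpl; field; assumption. Qed.

Lemma stretch_inj a b u v :
  0 < a -> 0 < b -> stretch a b u = stretch a b v -> u = v.
Proof.
  intros Ha Hb E.
  pose proof (f_equal fst E) as K1; pose proof (f_equal snd E) as K2.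
  simpl in K1, K2.
  apply C_eq; [apply (Rmult_eq_reg_l a) | apply (Rmult_eq_reg_l b)]; lra.
Qed.

Lemma on_std_ellipse a b u :
  a <> 0 -> b <> 0 -> on_conic (std_ellipse a b) (stretch a b u) <-> on_unit u.
Proof.
  intros Ha Hb; rewrite on_unit_sqr; unfold on_conic, conic_eval; simpl.
  replace (1 / (a * (a * 1)) * (a * fst u * (a * fst u * 1)) +
     0 * (a * fst u) * (b * snd u) +
     1 / (b * (b * 1)) * (b * snd u * (b * snd u * 1)) + 
     0 * (a * fst u) + 0 * (b * snd u) + -1)
   with (fst u ^ 2 + snd u ^ 2 - 1) by (field; split; assumption).
  simpl; split; lra.
Qed.

(** The chord through the unit numbers [u], [v] has the equation
    [z + pi conj z = si] with [pi = u v] and [si = u + v].  For fixed [u], the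
    tangency condition below is a quadratic equation in [v], whose roots are the
    other ends of the two tangents from [u].  The primed letters stand for
    conjugates; keeping them independent makes the next lemmas pure algebra. *)
Definition chord_poly (al al' be be' ep pi si : C) : C :=
  (be + be' * pi * pi + si * si - al * si - al' * si * pi + ep * pi)%C.

(** The leading and the constant coefficient of that quadratic equation in [v];
    the quotient [u blaschke_num / blaschke_den] is the Blaschke product with
    zeros at [0] and at the roots of [blaschke_num]. *)
Definition blaschke_den (al' be' u : C) : C := (1 - al' * u + be' * u * u)%C.
Definition blaschke_num (al be u : C) : C := (u * u - al * u + be)%C.

Section Family.
Local Open Scope C_scope.

(** Vieta for the quadratic equation satisfied by both [v] and [w]. *)
Lemma chord_roots (al al' be be' ep u v w : C) :
  v <> w ->
  chord_poly al al' be be' ep (u * v) (u + v) = 0 ->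
  chord_poly al al' be be' ep (u * w) (u + w) = 0 ->
  blaschke_den al' be' u * (v + w) = al - (2 + ep) * u + al' * u * u /\
  blaschke_num al be u = blaschke_den al' be' u * (v * w).
Proof.
  intros Hvw Hv Hw.
  assert (E : blaschke_den al' be' u * (v + w) = al - (2 + ep) * u + al' * u * u).
  { apply Ceq_minus.
    destruct (C_mult_eq_0 (v - w)
      (blaschke_den al' be' u * (v + w) - (al - (2 + ep) * u + al' * u * u)))
      as [K | K]; [| exfalso; exact (C_sub_neq_0 v w Hvw K) | exact K].
    transitivity (chord_poly al al' be be' ep (u * v) (u + v)
                  - chord_poly al al' be be' ep (u * w) (u + w)).
    - unfold chord_poly, blaschke_den; ring.
    - rewrite Hv, Hw; ring. }
  split; [exact E|].
  apply Ceq_minus.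
  transitivity (chord_poly al al' be be' ep (u * v) (u + v)
    - v * (blaschke_den al' be' u * (v + w) - (al - (2 + ep) * u + al' * u * u))).
  - unfold chord_poly, blaschke_num, blaschke_den; ring.
  - rewrite Hv, E; ring.
Qed.

(** Cayley's condition.  Eliminating the two other vertices by Vieta, the
    tangency of the third side becomes the product of the closing expression
    with the tangency polynomial of the tangent of the circle at [u]. *)
Lemma chord_triangle_closing (al al' be be' ep u v w : C) :
  v <> w ->
  chord_poly al al' be be' ep (u * v) (u + v) = 0 ->
  chord_poly al al' be be' ep (u * w) (u + w) = 0 ->
  chord_poly al al' be be' ep (v * w) (v + w) = 0 ->
  chord_poly al al' be be' ep (u * u) (u + u) <> 0 ->
  1 + ep + be * be' - al * al' = 0.
Proof.
  intros Hvw Hv Hw Hvw0 Hu.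
  destruct (chord_roots _ _ _ _ _ _ _ _ Hvw Hv Hw) as [ES EN].
  destruct (C_mult_eq_0 (1 + ep + be * be' - al * al')
    (chord_poly al al' be be' ep (u * u) (u + u))) as [K | K];
    [| exact K | contradiction].
  set (M := blaschke_den al' be' u) in *.
  set (S := al - (2 + ep) * u + al' * u * u) in *.
  set (N := blaschke_num al be u) in *.
  transitivity (be * M * M + be' * N * N + S * S - al * S * M
                - al' * S * N + ep * N * M).
  - unfold M, S, N, blaschke_den, blaschke_num, chord_poly; ring.
  - rewrite <- ES, EN.
    transitivity (M * M * chord_poly al al' be be' ep (v * w) (v + w)).
    + unfold chord_poly; ring.
    + rewrite Hvw0; ring.
Qed.

(** If the leading coefficient vanished, a linear equation with two distinct
    roots would be identically zero: every line through [u] would touch the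
    caustic, and so would the tangent of the circle at [u]. *)
Lemma blaschke_den_neq_0 (al al' be be' ep u v w : C) :
  v <> w ->
  chord_poly al al' be be' ep (u * v) (u + v) = 0 ->
  chord_poly al al' be be' ep (u * w) (u + w) = 0 ->
  chord_poly al al' be be' ep (u * u) (u + u) <> 0 ->
  blaschke_den al' be' u <> 0.
Proof.
  intros Hvw Hv Hw Hu HM.
  destruct (chord_roots _ _ _ _ _ _ _ _ Hvw Hv Hw) as [ES EN].
  rewrite HM in ES, EN.
  apply Hu.
  transitivity (u * u * blaschke_den al' be' u
    - u * (al - (2 + ep) * u + al' * u * u) + blaschke_num al be u).
  - unfold chord_poly, blaschke_num, blaschke_den; ring.
  - rewrite <- ES, EN, HM; ring.
Qed.

Lemma vertex_sum (al al' be be' ep u v w : C) :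
  v <> w ->
  chord_poly al al' be be' ep (u * v) (u + v) = 0 ->
  chord_poly al al' be be' ep (u * w) (u + w) = 0 ->
  chord_poly al al' be be' ep (v * w) (v + w) = 0 ->
  chord_poly al al' be be' ep (u * u) (u + u) <> 0 ->
  u + v + w = al + be' * (u * v * w).
Proof.
  intros Hvw Hv Hw Hvw0 Hu.
  pose proof (chord_triangle_closing _ _ _ _ _ _ _ _ Hvw Hv Hw Hvw0 Hu) as HC.
  pose proof (blaschke_den_neq_0 _ _ _ _ _ _ _ _ Hvw Hv Hw Hu) as HM.
  destruct (chord_roots _ _ _ _ _ _ _ _ Hvw Hv Hw) as [ES EN].
  apply Ceq_minus.
  destruct (C_mult_eq_0 (blaschke_den al' be' u)
     (u + v + w - (al + be' * (u * v * w)))) as [K | K];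
    [| contradiction | exact K].
  set (M := blaschke_den al' be' u) in *.
  transitivity (M * u + M * (v + w) - al * M - be' * u * (M * (v * w))); [ring|].
  rewrite ES, <- EN.
  transitivity (- u * (1 + ep + be * be' - al * al')).
  - unfold M, blaschke_den, blaschke_num; ring.
  - rewrite HC; ring.
Qed.
End Family.

(** The normalised coefficients of the dual of the squashed conic.  The first is
    twice its centre; the first two are the sum and the product of its foci, as
    complex numbers. *)
Definition foci_sum (a b : R) (Q : conic) : C :=
  (2 * adj13 Q / (a * adj33 Q), 2 * adj23 Q / (b * adj33 Q)).
Definition foci_prod (a b : R) (Q : conic) : C :=
  ((adj11 Q / a ^ 2 - adj22 Q / b ^ 2) / adj33 Q, 2 * adj12 Q / (a * b * adj33 Q)).
Definition chord_mid (a b : R) (Q : conic) : R :=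
  2 * (adj11 Q / a ^ 2 + adj22 Q / b ^ 2) / adj33 Q.

Definition tangency (a b : R) (Q : conic) : C -> C -> C :=
  chord_poly (foci_sum a b Q) (Cconj (foci_sum a b Q))
    (foci_prod a b Q) (Cconj (foci_prod a b Q)) (chord_mid a b Q).

(** The complex line coordinates [1 + pi], [i (1 - pi)], [- si] of a chord are
    real up to the common factor [k]. *)
Lemma tangency_dual_form a b Q (pi si : C) (l m n : R) (k : C) :
  a <> 0 -> b <> 0 -> adj33 Q <> 0 ->
  (k * (1 + pi) = RtoC (a * l))%C ->
  (k * (Ci * (1 - pi)) = RtoC (b * m))%C ->
  (k * (- si) = RtoC n)%C ->
  (k * k * tangency a b Q pi si * RtoC (adj33 Q) = RtoC (dual_form Q l m n))%C.
Proof.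
  intros Ha Hb HQ H1 H2 H3.
  assert (Hal : foci_sum a b Q = (2 * (adj13 Q / (a * adj33 Q))%R
      + 2 * Ci * (adj23 Q / (b * adj33 Q))%R)%C)
    by (apply C_eq; simpl; field; auto).
  assert (Hal' : Cconj (foci_sum a b Q) = (2 * (adj13 Q / (a * adj33 Q))%R
      - 2 * Ci * (adj23 Q / (b * adj33 Q))%R)%C)
    by (apply C_eq; simpl; field; auto).
  assert (Hbe : foci_prod a b Q = ((adj11 Q / a ^ 2 / adj33 Q)%R
     - (adj22 Q / b ^ 2 / adj33 Q)%R + 2 * Ci * (adj12 Q / (a * b * adj33 Q))%R)%C)
    by (apply C_eq; simpl; field; auto).
  assert (Hbe' : Cconj (foci_prod a b Q) = ((adj11 Q / a ^ 2 / adj33 Q)%R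
     - (adj22 Q / b ^ 2 / adj33 Q)%R - 2 * Ci * (adj12 Q / (a * b * adj33 Q))%R)%C)
    by (apply C_eq; simpl; field; auto).
  assert (Hep : RtoC (chord_mid a b Q) = (2 * (adj11 Q / a ^ 2 / adj33 Q)%R
     + 2 * (adj22 Q / b ^ 2 / adj33 Q)%R)%C)
    by (unfold chord_mid; apply C_eq; simpl; field; auto).
  unfold tangency, chord_poly; rewrite Hal', Hal, Hbe', Hbe, Hep.
  transitivity (RtoC (adj33 Q) * (
     RtoC (adj11 Q / a ^ 2 / adj33 Q) * (k * (1 + pi)) * (k * (1 + pi))
   + RtoC (adj22 Q / b ^ 2 / adj33 Q) * (k * (Ci * (1 - pi))) * (k * (Ci * (1 - pi)))
   + (k * - si) * (k * - si)
   + 2 * RtoC (adj12 Q / (a * b * adj33 Q)) * (k * (1 + pi)) * (k * (Ci * (1 - pi)))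
   + 2 * RtoC (adj13 Q / (a * adj33 Q)) * (k * (1 + pi)) * (k * - si)
   + 2 * RtoC (adj23 Q / (b * adj33 Q)) * (k * (Ci * (1 - pi))) * (k * - si)))%C.
  - ring [Ci2].
  - rewrite H1, H2, H3.
    repeat rewrite <- ?RtoC_mult, <- ?RtoC_plus.
    f_equal; unfold dual_form; field; auto.
Qed.

Lemma RtoC_fst_unit u : on_unit u -> RtoC (fst u) = ((u + / u) / 2)%C.
Proof.
  intros Hu; rewrite <- (unit_conj u Hu).
  transitivity (RtoC (Re u)); [reflexivity|]; apply re_alt.
Qed.

Lemma RtoC_snd_unit u : on_unit u -> RtoC (snd u) = (- Ci * (u - / u) / 2)%C.
Proof.
  intros Hu; rewrite <- (unit_conj u Hu).
  transitivity (RtoC (Im u)); [reflexivity|].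
  pose proof C2_neq_0; pose proof Ci_nz.
  rewrite im_alt; field_simplify_eq; [ring [Ci2] | auto].
Qed.

(** Up to a nonzero factor, the area of a triangle on the unit circle is the
    Vandermonde product of its vertices. *)
Lemma collinear_units a b u v w :
  a <> 0 -> b <> 0 -> on_unit u -> on_unit v -> on_unit w ->
  collinear (stretch a b u) (stretch a b v) (stretch a b w) ->
  u = v \/ u = w \/ v = w.
Proof.
  intros Ha Hb Hu Hv Hw H.
  assert (K : (fst v - fst u) * (snd w - snd u) - (snd v - snd u) * (fst w - fst u) = 0).
  { unfold collinear in H; simpl in H.
    apply (Rmult_eq_reg_l (a * b)); [lra|].
    apply Rmult_integral_contrapositive; split; assumption. }
  pose proof (unit_neq_0 u Hu); pose proof (unit_neq_0 v Hv);
  pose proof (unit_neq_0 w Hw).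
  pose proof C2_neq_0 as Htwo.
  assert (P : ((v - u) * (w - u) * (w - v) = 0)%C).
  { transitivity (- 2 * Ci * (u * v * w) * RtoC ((fst v - fst u) * (snd w - snd u) - (snd v - snd u) * (fst w - fst u)))%C.
    - rewrite RtoC_minus, 2!RtoC_mult, 4!RtoC_minus.
      rewrite !RtoC_fst_unit, !RtoC_snd_unit by assumption.
      field_simplify_eq; [| repeat split; assumption].
      ring_simplify [Ci2]; ring.
    - rewrite K; ring. }
  apply C_mult_eq_0 in P as [P | P]; [apply C_mult_eq_0 in P as [P | P] |];
    apply Ceq_minus in P; auto.
Qed.

Section Nested.
Variables (a b : R) (Q : conic).
Hypotheses (ha : 0 < a) (hb : 0 < b).
Hypotheses (HQ : 0 < adj33 Q) (hn : nested Q a b).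

Lemma side_tangency u v :
  on_unit u -> on_unit v -> u <> v ->
  line_tangent Q (stretch a b u) (stretch a b v) ->
  tangency a b Q (u * v) (u + v) = 0%C.
Proof.
  intros Hu Hv Huv HT.
  pose proof (unit_neq_0 u Hu); pose proof (unit_neq_0 v Hv).
  pose proof C2_neq_0 as Htwo.
  apply dual_form_tangent in HT; [| assumption |].
  2:{ intros E; apply Huv, (stretch_inj a b); assumption. }
  (* [k] makes the complex coordinates of the chord real: with unit [u], [v],
     the chord direction [v - u] is a real multiple of [i] times a root of
     [u v]. *)
  pose (k := (RtoC (a * b) * Ci * (v - u) / (2 * (u * v)))%C).
  assert (Hk : k <> 0%C).
  { unfold k, Cdiv; repeat apply Cmult_neq_0.
    - intros K; apply RtoC_inj in K; nra.
    - apply Ci_nz.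
    - apply C_sub_neq_0; auto.
    - apply C_inv_neq_0; repeat apply Cmult_neq_0; assumption. }
  pose proof (tangency_dual_form a b Q (u * v)%C (u + v)%C 
    (snd (stretch a b u) - snd (stretch a b v))
    (fst (stretch a b v) - fst (stretch a b u))
    (fst (stretch a b u) * snd (stretch a b v) - snd (stretch a b u) * fst (stretch a b v))
    k ltac:(lra) ltac:(lra) ltac:(lra)) as K.
  rewrite HT in K.
  destruct (C_mult_eq_0 (k * k * tangency a b Q (u * v) (u + v)) (RtoC (adj33 Q)))
    as [E | E].
  - apply K; unfold k; cbn [fst snd stretch].
    + transitivity (RtoC (a * b) * (RtoC (snd u) - RtoC (snd v)))%C;
        [| rewrite <- RtoC_minus, <- RtoC_mult; f_equal; ring].
      rewrite !RtoC_snd_unit by assumption; field; repeat split; assumption.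
    + transitivity (RtoC (a * b) * (RtoC (fst v) - RtoC (fst u)))%C;
        [| rewrite <- RtoC_minus, <- RtoC_mult; f_equal; ring].
      rewrite !RtoC_fst_unit by assumption.
      field_simplify_eq; [| repeat split; assumption]; ring [Ci2].
    + transitivity (RtoC (a * b) * (RtoC (fst u) * RtoC (snd v) - RtoC (snd u) * RtoC (fst v)))%C;
        [| rewrite <- !RtoC_mult, <- RtoC_minus, <- RtoC_mult; f_equal; ring].
      rewrite !RtoC_fst_unit, !RtoC_snd_unit by assumption.
      field; repeat split; assumption.
  - apply C_mult_eq_0 in E as [E | E]; [| exact E].
    apply C_mult_eq_0 in E as [E | E]; contradiction.
  - exfalso; apply RtoC_inj in E; lra.
Qed.

(** A tangent of the outer ellipse has no point strictly inside, whereas a line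
    that touches the caustic contains a point of it. *)
Lemma tangent_at_unit_not_tangency u :
  on_unit u -> tangency a b Q (u * u) (u + u) <> 0%C.
Proof.
  intros Hu E.
  pose proof (unit_neq_0 u Hu).
  pose proof C2_neq_0 as Htwo.
  pose (D := (- a * snd u, b * fst u) : point).
  pose proof (proj1 (on_unit_sqr u) Hu) as Hu2.
  destruct (dual_form_meets Q (stretch a b u) D HQ) as [s Hs].
  - intros K; pose proof (f_equal fst K) as K1; pose proof (f_equal snd K) as K2.
    simpl in K1, K2.
    assert (snd u = 0) by (apply (Rmult_eq_reg_l (- a)); lra).
    assert (fst u = 0) by (apply (Rmult_eq_reg_l b); lra).
    nra.
  - apply RtoC_inj.
    rewrite <- (tangency_dual_form a b Q (u * u)%C (u + u)%C _ _ _
      (- RtoC (a * b) / (2 * u))%C); try lra.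
    + rewrite E; ring.
    + unfold D; cbn [fst snd].
      transitivity (- RtoC (a * b) * RtoC (fst u))%C;
        [| rewrite <- RtoC_opp, <- RtoC_mult; f_equal; ring].
      rewrite RtoC_fst_unit by assumption; field; auto.
    + unfold D; cbn [fst snd].
      transitivity (- RtoC (a * b) * RtoC (snd u))%C;
        [| rewrite <- RtoC_opp, <- RtoC_mult; f_equal; ring].
      rewrite RtoC_snd_unit by assumption; field; auto.
    + transitivity (RtoC (a * b)); [field; auto|].
      f_equal; unfold D, stretch; cbn [fst snd].
      transitivity (a * b * (fst u ^ 2 + snd u ^ 2)); [rewrite Hu2|]; ring.
  - apply hn in Hs; unfold along, D in Hs; simpl in Hs.
    replace ((a * fst u + s * (- a * snd u)) / a) with (fst u - s * snd u) in Hs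
      by (field; lra).
    replace ((b * snd u + s * (b * fst u)) / b) with (snd u + s * fst u) in Hs
      by (field; lra).
    assert (0 <= s ^ 2) by apply pow2_ge_0.
    assert (s ^ 2 * (fst u ^ 2 + snd u ^ 2) = s ^ 2) by (rewrite Hu2; ring).
    nra.
Qed.

Lemma poncelet_units V1 V2 V3 :
  poncelet_triangle (std_ellipse a b) Q V1 V2 V3 ->
  exists u v w : C,
    V1 = stretch a b u /\ V2 = stretch a b v /\ V3 = stretch a b w /\
    on_unit u /\ on_unit v /\ on_unit w /\ u <> v /\ v <> w /\ w <> u /\
    tangency a b Q (u * v) (u + v) = 0%C /\
    tangency a b Q (v * w) (v + w) = 0%C /\
    tangency a b Q (w * u) (w + u) = 0%C.
Proof.
  intros (Hc & H1 & H2 & H3 & T1 & T2 & T3).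
  exists (squash a b V1), (squash a b V2), (squash a b V3).
  rewrite !stretch_squash by lra.
  assert (U : forall V, on_conic (std_ellipse a b) V -> on_unit (squash a b V)).
  { intros V HV; rewrite <- (on_std_ellipse a b), stretch_squash; auto; lra. }
  assert (I : forall V W, squash a b V = squash a b W -> V = W).
  { intros V W E; rewrite <- (stretch_squash a b V), E, stretch_squash; auto; lra. }
  assert (N12 : squash a b V1 <> squash a b V2)
    by (intros E; apply Hc; rewrite (I _ _ E); red; ring).
  assert (N23 : squash a b V2 <> squash a b V3)
    by (intros E; apply Hc; rewrite (I _ _ E); red; ring).
  assert (N31 : squash a b V3 <> squash a b V1)
    by (intros E; apply Hc; rewrite (I _ _ E); red; ring).
  repeat (split; [now auto |]).
  repeat split; try apply side_tangency; auto; rewrite !stretch_squash; auto; lra.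
Qed.

End Nested.

(** * Poncelet triangles as fibres of a Blaschke product *)

Definition blaschke_triangle (al be u v w : C) : Prop :=
  (on_unit u /\ on_unit v /\ on_unit w) /\ (u <> v /\ v <> w /\ w <> u) /\
  (u + v + w = al + Cconj be * (u * v * w))%C.

(** The conjugate of the relation for the sum: on the unit circle,
    conjugation turns the sum of the vertices into the sum of the pairwise
    products divided by the product. *)
Lemma blaschke_pairs al be u v w :
  blaschke_triangle al be u v w ->
  (u * v + v * w + w * u = be + Cconj al * (u * v * w))%C.
Proof.
  intros ((Hu & Hv & Hw) & _ & H).
  pose proof (f_equal Cconj H) as K.
  rewrite !Cplus_conj, !Cmult_conj, Cconj_conj, !unit_conj in K by assumption.
  pose proof (unit_neq_0 u Hu); pose proof (unit_neq_0 v Hv);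
  pose proof (unit_neq_0 w Hw).
  transitivity (u * v * w * (/ u + / v + / w))%C; [field; auto|].
  rewrite K; field; auto.
Qed.

(** By the relations for the sum and the pairwise products, the difference of
    the two sides is the monic cubic in [p] with roots [u], [v], [w]. *)
Lemma blaschke_vertex al be u v w p :
  blaschke_triangle al be u v w ->
  (p * blaschke_num al be p = u * v * w * blaschke_den (Cconj al) (Cconj be) p)%C <->
  (p = u \/ p = v \/ p = w).
Proof.
  intros H; pose proof (blaschke_pairs _ _ _ _ _ H) as E2.
  destruct H as (_ & _ & E1).
  assert (F : (p * blaschke_num al be p - u * v * w * blaschke_den (Cconj al) (Cconj be) p
               = (p - u) * (p - v) * (p - w))%C).
  { transitivity (p * p * p - (u + v + w) * p * p
                  + (u * v + v * w + w * u) * p - u * v * w)%C; [| ring].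
    rewrite E1, E2; unfold blaschke_num, blaschke_den; ring. }
  rewrite Ceq_minus, F; split.
  - intros E; apply C_mult_eq_0 in E as [E | E];
      [apply C_mult_eq_0 in E as [E | E] |]; apply Ceq_minus in E; auto.
  - intros [-> | [-> | ->]]; ring.
Qed.

Lemma antiperiodic_zero (f : R -> R) (T : R) :
  0 < T -> continuity f -> f T = - f 0 -> exists x : R, f x = 0.
Proof.
  intros HT Hf E.
  destruct (Rtotal_order (f 0) 0) as [H | [H | H]].
  - destruct (IVT f 0 T Hf HT H) as [z Hz]; [lra |]; exists z; apply Hz.
  - exists 0; exact H.
  - destruct (IVT (- f)%F 0 T) as [z Hz]; try (unfold opp_fct; lra).
    + apply continuity_opp; exact Hf.
    + exists z; destruct Hz as [_ Hz]; unfold opp_fct in Hz; lra.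
Qed.

(** Divided by [u^(3/2)] and by a square root of [la], the difference of the two
    sides is purely imaginary along the circle.  Since the degree is three, only
    odd multiples of the half angle occur, so a full turn changes the sign and a
    zero lies in between. *)
Lemma blaschke_surjective (al be la : C) :
  on_unit la ->
  exists u : C, on_unit u /\
    (u * blaschke_num al be u = la * blaschke_den (Cconj al) (Cconj be) u)%C.
Proof.
  intros Hla; destruct (unit_sqrt la Hla) as (r & Hr & <-).
  pose (half := fun s : R => (cos s, sin s) : C).
  pose (g := fun s : R =>
    (half s * half s * half s * Cconj r
     - al * half s * Cconj r + be * Cconj (half s) * Cconj r)%C).
  destruct (antiperiodic_zero (fun s => snd (g s)) PI PI_RGT_0) as [s Hs].
  - intros s; apply derivable_continuous_pt.
    apply ex_derive_Reals_0.
    unfold g, half; simpl; auto_derive; trivial.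
  (* [s] is half of the argument of the root, so [PI] is a full turn. *)
  - assert (E : half PI = (- half 0)%C)
      by (unfold half; apply C_eq; simpl;
          rewrite ?cos_PI, ?sin_PI, ?cos_0, ?sin_0; ring).
    transitivity (snd (- g 0)%C); [| reflexivity].
    f_equal; unfold g; rewrite E, Copp_conj; ring.
  - assert (Hh : on_unit (half s)) by apply unit_cis.
    set (h := half s) in *.
    exists (h * h)%C; split; [apply unit_mult; assumption|].
    assert (Hg : Cconj (g s) = g s).
    { apply C_eq; [reflexivity|].
      change (- snd (g s) = snd (g s)); cbv beta in Hs; rewrite Hs; ring. }
    pose proof (unit_neq_0 h Hh); pose proof (unit_neq_0 r Hr).
    unfold g in Hg; fold h in Hg.
    push_conj Hg.
    rewrite (unit_conj h Hh), (unit_conj r Hr) in Hg.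
    unfold blaschke_num, blaschke_den.
    transitivity (h * h * h * r * ( h * h * h * / r - al * h * / r + be * / h * / r))%C;
      [field; auto|].
    rewrite <- Hg; field; auto.
Qed.

Section Porism.
Variables (a b : R) (Q : conic).
Hypotheses (ha : 0 < a) (hb : 0 < b).
Hypotheses (HQ : 0 < adj33 Q) (hn : nested Q a b).
Let al := foci_sum a b Q.
Let be := foci_prod a b Q.

Lemma poncelet_blaschke V1 V2 V3 :
  poncelet_triangle (std_ellipse a b) Q V1 V2 V3 ->
  exists u v w : C,
    V1 = stretch a b u /\ V2 = stretch a b v /\ V3 = stretch a b w /\
    blaschke_triangle al be u v w /\
    blaschke_den (Cconj al) (Cconj be) u <> 0%C /\
    (1 + chord_mid a b Q + be * Cconj be - al * Cconj al = 0)%C.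
Proof.
  intros H.
  destruct (poncelet_units a b Q ha hb HQ V1 V2 V3 H)
    as (u & v & w & E1 & E2 & E3 & Hu & Hv & Hw & N12 & N23 & N31 & C12 & C23 & C31).
  exists u, v, w; repeat (split; [assumption|]).
  rewrite (Cmult_comm w u), (Cplus_comm w u) in C31.
  pose proof (tangent_at_unit_not_tangency a b Q ha hb HQ hn u Hu) as T.
  split; [| split].
  - split; [| split]; auto.
    exact (vertex_sum _ _ _ _ _ u v w N23 C12 C31 C23 T).
  - exact (blaschke_den_neq_0 _ _ _ _ _ u v w N23 C12 C31 T).
  - exact (chord_triangle_closing _ _ _ _ _ u v w N23 C12 C31 C23 T).
Qed.

Hypothesis hp : admits_porism (std_ellipse a b) Q.

Lemma poncelet_at_vertex u :
  on_unit u ->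
  blaschke_den (Cconj al) (Cconj be) u <> 0%C /\
  exists v w : C,
    poncelet_triangle (std_ellipse a b) Q (stretch a b u) (stretch a b v) (stretch a b w) /\
    blaschke_triangle al be u v w.
Proof.
  intros Hu.
  destruct (hp (stretch a b u)) as (V2 & V3 & H).
  - apply on_std_ellipse; auto; lra.
  - destruct (poncelet_blaschke _ _ _ H)
      as (u' & v & w & E1 & -> & -> & HB & HM & _).
    assert (u = u') as <-.
    { apply (stretch_inj a b); assumption. }
    split; [exact HM|]; exists v, w; split; assumption.
Qed.

(** The porism completes a root of the cubic of [la] to a triangle of the family,
    and that triangle has product [la] because [blaschke_den] does not vanish at
    the root. *)
Lemma poncelet_of_product la :
  on_unit la ->
  exists u v w : C,
    poncelet_triangle (std_ellipse a b) Q (stretch a b u) (stretch a b v) (stretch a b w) /\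
    blaschke_triangle al be u v w /\ (u * v * w = la)%C.
Proof.
  intros Hla; destruct (blaschke_surjective al be la Hla) as (u & Hu & E).
  destruct (poncelet_at_vertex u Hu) as (HM & v & w & HT & HB).
  exists u, v, w; repeat (split; [assumption|]).
  apply Ceq_minus.
  destruct (C_mult_eq_0 (u * v * w - la)%C (blaschke_den (Cconj al) (Cconj be) u))
    as [K | K]; [| exact K | contradiction].
  pose proof (proj2 (blaschke_vertex al be u v w u HB) (or_introl eq_refl)) as E'.
  transitivity (u * v * w * blaschke_den (Cconj al) (Cconj be) u
                - la * blaschke_den (Cconj al) (Cconj be) u)%C; [ring|].
  rewrite <- E, <- E'; ring.
Qed.

Lemma closing_relation :
  1 + chord_mid a b Q + (fst be ^ 2 + snd be ^ 2) - (fst al ^ 2 + snd al ^ 2) = 0.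
Proof.
  destruct (hp (stretch a b 1)) as (V2 & V3 & H).
  - apply on_std_ellipse; try lra; apply on_unit_sqr; simpl; ring.
  - destruct (poncelet_blaschke _ _ _ H) as (u & v & w & _ & _ & _ & _ & _ & K).
    revert K; generalize (chord_mid a b Q) al be; intros e [x y] [x' y'] K.
    apply (f_equal fst) in K; simpl in K |- *; lra.
Qed.

End Porism.

(** * The isogonal conjugate in closed form *)

(** Reflecting [P - V] about the bisector gives a positive multiple of
    [(U - V) (W - V) conj (P - V)], since the bisector halves the angle of the
    two sides; the form vanishes iff [g - gw V] is a real multiple of it. *)
Definition iso_form (V U W P g : C) (gw : R) : R :=
  Im (Cconj (g - gw * V) * ((U - V) * (W - V) * Cconj (P - V)))%C.

(** For unit [e], [f] the square of [e + f] is a real multiple of [e f], so the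
    reflection in the line of [e + f] is [q |-> e f conj q]; the left side is
    twice a projection. *)
Lemma reflect_units (e f q : C) :
  on_unit e -> on_unit f -> (e + f)%C <> 0%C ->
  (pscale (2 * dot q (padd e f) / dot (padd e f) (padd e f)) (padd e f) : C)
  = (q + e * f * Cconj q)%C.
Proof.
  intros He Hf Hef.
  apply on_unit_sqr in He; apply on_unit_sqr in Hf.
  assert (HD : dot (padd e f) (padd e f) <> 0).
  { unfold dot, padd; cbn [fst snd]; intros K; apply Hef.
    destruct (Rplus_sqr_eq_0 _ _ K) as [K1 K2].
    apply C_eq; assumption. }
  assert (E1 : fst e ^ 2 = 1 - snd e ^ 2) by lra.
  assert (E2 : fst f ^ 2 = 1 - snd f ^ 2) by lra.
  unfold dot, padd in HD; cbn [fst snd] in HD.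
  unfold pscale, dot, padd.
  apply C_eq; cbn [fst snd Cplus Cmult Cconj]; field_simplify_eq;
    try assumption; ring [E1 E2].
Qed.

Lemma norm2_pos (A : point) : A <> (0, 0) -> 0 < norm2 A.
Proof.
  intros H; apply sqrt_lt_R0; unfold dot.
  destruct A as [x y]; cbn [fst snd].
  destruct (Req_dec x 0) as [-> | Hx]; [| nra].
  destruct (Req_dec y 0) as [-> | Hy]; [exfalso; apply H; reflexivity | nra].
Qed.

Lemma normalize_unit (A : point) :
  A <> (0, 0) -> on_unit (pscale (/ norm2 A) A).
Proof.
  intros H; pose proof (norm2_pos A H) as Hn.
  assert (E : norm2 A * norm2 A = dot A A).
  { apply sqrt_sqrt; unfold dot; nra. }
  apply on_unit_sqr; unfold pscale; cbn [fst snd].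
  transitivity (dot A A / (norm2 A * norm2 A));
    [unfold dot; field; lra | rewrite E; apply Rdiv_diag; nra].
Qed.

Lemma incident_reflected (V U W P g : C) (gw : R) :
  ~ collinear V U W ->
  (incident (reflected_cevian V U W P) (fst g, snd g, gw) <->
   iso_form V U W P g gw = 0).
Proof.
  intros Hc.
  assert (HU : psub U V <> (0, 0)).
  { intros E; injection E as E1 E2; apply Hc; unfold collinear; rewrite E1, E2; ring. }
  assert (HW : psub W V <> (0, 0)).
  { intros E; injection E as E1 E2; apply Hc; unfold collinear; rewrite E1, E2; ring. }
  pose proof (norm2_pos _ HU) as H1; pose proof (norm2_pos _ HW) as H2.
  pose proof (normalize_unit _ HU) as Ue; pose proof (normalize_unit _ HW) as Uf.
  set (e := pscale (/ norm2 (psub U V)) (psub U V)) in *.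
  set (f := pscale (/ norm2 (psub W V)) (psub W V)) in *.
  assert (Hef : (e + f)%C <> 0%C).
  { intros E; apply Hc.
    pose proof (f_equal fst E) as E1; pose proof (f_equal snd E) as E2.
    unfold e, f in E1, E2; cbn [fst snd Cplus RtoC pscale psub] in E1, E2.
    unfold collinear.
    set (n1 := norm2 (psub U V)) in *; set (n2 := norm2 (psub W V)) in *.
    assert (F1 : fst U - fst V = - n1 * (/ n2 * (fst W - fst V))).
    { apply (Rmult_eq_reg_l (/ n1)); [| apply Rinv_neq_0_compat; lra].
      transitivity (- (/ n2 * (fst W - fst V))); [lra | field; lra]. }
    assert (F2 : snd U - snd V = - n1 * (/ n2 * (snd W - snd V))).
    { apply (Rmult_eq_reg_l (/ n1)); [| apply Rinv_neq_0_compat; lra].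
      transitivity (- (/ n2 * (snd W - snd V))); [lra | field; lra]. }
    rewrite F1, F2; ring. }
  pose proof (reflect_units e f (psub P V) Ue Uf Hef) as R.
  unfold reflected_cevian, reflect, bisector_direction.
  fold e f; rewrite R.
  set (n1 := norm2 (psub U V)) in *; set (n2 := norm2 (psub W V)) in *.
  assert (K : (let '(l, m, n) := join (hom V)
         (hom (psub (padd V (psub P V + e * f * Cconj (psub P V))%C) (psub P V))) in
      l * fst g + m * snd g + n * gw) = - / (n1 * n2) * iso_form V U W P g gw).
  { unfold join, hom, iso_form, e, f, Im.
    cbn [fst snd psub padd Cplus Cmult Cconj pscale Cminus Copp RtoC].
    field; lra. }
  unfold incident.
  destruct (join (hom V)
         (hom (psub (padd V (psub P V + e * f * Cconj (psub P V))%C) (psub P V))))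
    as [[l m] n].
  rewrite K; split.
  - intros E; apply Rmult_integral in E as [E | E]; [| exact E].
    exfalso; revert E; apply Ropp_neq_0_compat, Rinv_neq_0_compat; nra.
  - intros ->; ring.
Qed.

(** Homogeneous coordinates of the squashed isogonal conjugate.  The quotient
    [(p - al + conj ga la) / (p la - 1)] has a complex denominator; with
    [r^2 = p la], multiplying both terms by [- i conj r] makes the denominator
    the real number [2 Im r].  Both coordinates are then real-linear in [r]. *)
Definition gP_coord (al ga p r : C) : C :=
  (- Ci * ((p - al) * Cconj r + Cconj ga * Cconj p * r))%C.

Definition axis_ratio (a b : R) : R := (a ^ 2 + b ^ 2) / (a ^ 2 - b ^ 2).

Definition gP_hom (a b : R) (al ga p r : C) : triple :=
  (fst (stretch a b (gP_coord al ga p r)), snd (stretch a b (gP_coord al ga p r)),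
   2 * snd r).

Lemma stretch_C a b u :
  stretch a b u = (RtoC ((a + b) / 2) * u + RtoC ((a - b) / 2) * Cconj u)%C.
Proof. apply C_eq; simpl; field. Qed.

Lemma stretch_conj a b u : Cconj (stretch a b u) = stretch a b (Cconj u).
Proof. apply C_eq; simpl; ring. Qed.

(** The coordinates come from the barycentrics [l_i^2 / z_i]: for a point of the
    circumscribed ellipse they are [l_i^2 (p - u_i) / (u_i (u_j - u_k))] up
    to a common factor; as [(u_j - u_k)^2] divides [l_i^2], the weighted sums are
    divided differences in the [u_i].
    Here it is enough to verify the three reflected cevians, as a rational
    identity between unit numbers. *)
Lemma iso_form_gP a b u v w p r :
  0 < a -> 0 < b -> a <> b ->
  on_unit u -> on_unit v -> on_unit w -> on_unit r ->
  p = (r * r / (u * v * w))%C ->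
  iso_form (stretch a b u) (stretch a b v) (stretch a b w) (stretch a b p)
    (stretch a b (- Ci * Cconj r * (p - (u + v + w) + 2 * axis_ratio a b * (u * v * w))))
    (2 * snd r) = 0.
Proof.
  intros Ha Hb Hab Hu Hv Hw Hr ->.
  pose proof (unit_neq_0 u Hu); pose proof (unit_neq_0 v Hv);
  pose proof (unit_neq_0 w Hw); pose proof (unit_neq_0 r Hr).
  pose proof C2_neq_0 as Htwo; pose proof Ci_nz.
  pose (s := (a + b) / 2); pose (d := (a - b) / 2).
  assert (Hs : RtoC s <> 0%C)
    by (intros K; apply RtoC_inj in K; unfold s in K; lra).
  assert (Hd : RtoC d <> 0%C)
    by (intros K; apply RtoC_inj in K; apply Hab; unfold d in K; lra).
  assert (Hk : RtoC (axis_ratio a b) = ((s * s + d * d) / (2 * (s * d)))%C).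
  { rewrite <- !RtoC_mult, <- RtoC_plus, <- RtoC_div; [f_equal|];
    unfold axis_ratio, s, d.
    - field; split; nra.
    - nra. }
  assert (Hgw : RtoC (2 * snd r) = (- Ci * (r - / r))%C).
  { rewrite RtoC_mult, RtoC_snd_unit by assumption; field; auto. }
  apply RtoC_inj; unfold iso_form; rewrite im_alt.
  assert (Hcs : forall z, Cconj (stretch a b z) = (s * Cconj z + d * z)%C).
  { intros z; rewrite stretch_conj, stretch_C, Cconj_conj; reflexivity. }
  assert (Hi : Cconj Ci = (- Ci)%C) by (apply C_eq; simpl; ring).
  assert (Hp : Cconj (r * r / (u * v * w)) = (u * v * w / (r * r))%C).
  { rewrite Cdiv_conj, !Cmult_conj, !unit_conj; auto.
    - field; auto.
    - repeat apply Cmult_neq_0; assumption. }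
  repeat first [rewrite Cplus_conj | rewrite Cminus_conj
      | rewrite Cmult_conj | rewrite Cconj_conj | rewrite Hcs].
  rewrite !stretch_C; fold s d.
  repeat first [rewrite Cplus_conj | rewrite Cminus_conj
      | rewrite Cmult_conj | rewrite Cconj_conj | rewrite Copp_conj].
  rewrite Hp, !Cconj_R, Hi, Hgw, Hk.
  rewrite !unit_conj by assumption.
  set (s' := RtoC s) in *; set (d' := RtoC d) in *.
  clearbody s' d'; clear -H H0 H1 H2 Hs Hd Htwo H3.
  match goal with |- (?x / ?y)%C = _ => assert (E : x = 0%C) end.
  { field_simplify_eq.
    - ring [Ci2].
    - repeat split; assumption. }
  rewrite E; unfold Cdiv; ring.
Qed.

Lemma axis_ratio_sqr_gt_1 a b : 0 < a -> 0 < b -> a <> b -> 1 < axis_ratio a b ^ 2.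
Proof.
  intros Ha Hb Hab.
  assert (H : a ^ 2 - b ^ 2 <> 0)
    by (replace (a ^ 2 - b ^ 2) with ((a - b) * (a + b)) by ring;
        apply Rmult_integral_contrapositive; lra).
  assert (0 < (a ^ 2 - b ^ 2) ^ 2) by (apply pow2_gt_0; exact H).
  unfold axis_ratio; apply Rminus_lt_0.
  replace ((_ / _) ^ 2 - 1) with (4 * a ^ 2 * b ^ 2 / (a ^ 2 - b ^ 2) ^ 2)
    by (field; exact H).
  apply Rdiv_lt_0_compat; [| assumption].
  assert (0 < a ^ 2) by nra; assert (0 < b ^ 2) by nra; nra.
Qed.

(** With this constant, substituting the sum [al + conj be la] of the vertices in
    [p - (u + v + w) + 2 k la] gives [p - al + conj gamma la]. *)
Definition gamma (a b : R) (be : C) : C := (2 * axis_ratio a b - be)%C.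

(** A zero means that numerator and denominator of the isogonal conjugate vanish
    together at [la = conj p].  The cubic of the triangle of that product would
    then factor as [(x - p) (x^2 - 2 k conj p x + conj p ^ 2)].  For a unit root
    [x] of the second factor [Re (x p) = k], which is impossible as [|k| > 1];
    so the triangle would have the single vertex [p]. *)
Lemma gP_dir_neq_0 a b al be p u v w :
  0 < a -> 0 < b -> a <> b -> on_unit p ->
  blaschke_triangle al be u v w -> (u * v * w = Cconj p)%C ->
  (p - al + Cconj (gamma a b be) * Cconj p)%C <> 0%C.
Proof.
  intros Ha Hb Hab Hp HB Hl E.
  pose proof (axis_ratio_sqr_gt_1 a b Ha Hb Hab) as Hk; set (k := axis_ratio a b) in *.
  pose proof (blaschke_pairs _ _ _ _ _ HB) as E2.
  destruct HB as ((Hu & Hv & Hw) & (N & _) & E1).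
  rewrite Hl in E1, E2.
  pose proof (unit_neq_0 p Hp) as Hp0.
  pose proof C2_neq_0 as Htwo.
  assert (Eg : Cconj (gamma a b be) = (2 * k - Cconj be)%C).
  { unfold gamma; rewrite Cminus_conj, Cmult_conj, !Cconj_R; reflexivity. }
  rewrite Eg in E.
  assert (S1 : (u + v + w = p + 2 * k * Cconj p)%C).
  { rewrite E1; apply Ceq_minus.
    transitivity (- (p - al + (2 * k - Cconj be) * Cconj p))%C; [ring|].
    rewrite E; ring. }
  assert (S2 : (u * v + v * w + w * u = Cconj p * Cconj p + 2 * k)%C).
  { rewrite E2; apply (f_equal Cconj) in E.
    push_conj E.
    apply Ceq_minus.
    transitivity (- Cconj p * (Cconj p - Cconj al + (2 * k - be) * p)
      + (2 * k - be) * (p * Cconj p - 1))%C; [ring|].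
    rewrite E, Hp; ring. }
  assert (R : forall x : C, on_unit x -> x = u \/ x = v -> x = p).
  { intros x Hx Hxuv.
    assert (F : ((x - p) * (x * x - 2 * k * Cconj p * x + Cconj p * Cconj p) = 0)%C).
    { transitivity ((x - u) * (x - v) * (x - w))%C.
      - transitivity (x * x * x - (u + v + w) * x * x
                  + (u * v + v * w + w * u) * x - u * v * w)%C; [| ring].
        rewrite S1, S2, Hl, (unit_conj p Hp); field; exact Hp0.
      - destruct Hxuv as [-> | ->]; ring. }
    apply C_mult_eq_0 in F as [F | F]; [apply Ceq_minus; exact F|].
    exfalso.
    pose proof (unit_mult x p Hx Hp) as Hxp.
    pose proof (unit_neq_0 x Hx) as Hx0.
    assert (G : RtoC (fst (x * p)%C) = RtoC k).
    { rewrite RtoC_fst_unit by exact Hxp.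
      apply Ceq_minus.
      transitivity (p / (2 * x) *
        (x * x - 2 * k * Cconj p * x + Cconj p * Cconj p))%C.
      - rewrite (unit_conj p Hp); field; auto.
      - rewrite F; ring. }
    apply RtoC_inj in G; apply on_unit_sqr in Hxp; rewrite G in Hxp; nra. }
  apply N; rewrite (R u), (R v); auto.
Qed.

(** Two lines, each through just one of two given points, are distinct, so they
    meet in a single projective point, their cross product. *)
Lemma meet_unique (L1 L2 A B G G' : triple) :
  incident L1 A -> ~ incident L1 B -> incident L2 B -> ~ incident L2 A ->
  incident L1 G -> incident L2 G -> incident L1 G' -> incident L2 G' ->
  G <> (0, 0, 0) -> G' <> (0, 0, 0) -> proportional G G'.
Proof.
  destruct L1 as [[l1 m1] n1], L2 as [[l2 m2] n2], A as [[xa ya] wa],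
    B as [[xb yb] wb], G as [[x y] w], G' as [[x' y'] w']; simpl.
  intros HA HnB HB HnA G1 G2 G1' G2' HG HG'.
  set (c1 := m1 * n2 - n1 * m2); set (c2 := n1 * l2 - l1 * n2);
  set (c3 := l1 * m2 - m1 * l2).
  set (N := c1 ^ 2 + c2 ^ 2 + c3 ^ 2).
  assert (HN : N <> 0).
  { intros K.
    assert (c1 = 0 /\ c2 = 0 /\ c3 = 0) as (K1 & K2 & K3)
      by (unfold N in K; repeat split; nra).
    assert (E : (l1 * xb + m1 * yb + n1 * wb) * (l2 * xa + m2 * ya + n2 * wa) = 0).
    { transitivity ((l1 * xa + m1 * ya + n1 * wa) * (l2 * xb + m2 * yb + n2 * wb)
        + c1 * (yb * wa - wb * ya) + c2 * (wb * xa - xb * wa) + c3 * (xb * ya - yb * xa)).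
      - unfold c1, c2, c3; ring.
      - rewrite HA, K1, K2, K3; ring. }
    apply Rmult_integral in E as [E | E]; contradiction. }
  assert (P : forall x y w, l1 * x + m1 * y + n1 * w = 0 ->
     l2 * x + m2 * y + n2 * w = 0 -> (x, y, w) <> (0, 0, 0) ->
     exists k, k <> 0 /\ x = k * c1 /\ y = k * c2 /\ w = k * c3).
  { clear -HN; intros x y w H1 H2 H0.
    exists ((x * c1 + y * c2 + w * c3) / N).
    assert (E1 : y * c3 - w * c2 = 0).
    { transitivity (l1 * (l2 * x + m2 * y + n2 * w) - l2 * (l1 * x + m1 * y + n1 * w));
        [unfold c2, c3; ring | rewrite H1, H2; ring]. }
    assert (E2 : w * c1 - x * c3 = 0).
    { transitivity (m1 * (l2 * x + m2 * y + n2 * w) - m2 * (l1 * x + m1 * y + n1 * w));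
        [unfold c1, c3; ring | rewrite H1, H2; ring]. }
    assert (E3 : x * c2 - y * c1 = 0).
    { transitivity (n1 * (l2 * x + m2 * y + n2 * w) - n2 * (l1 * x + m1 * y + n1 * w));
        [unfold c1, c2; ring | rewrite H1, H2; ring]. }
    assert (Ex : x = (x * c1 + y * c2 + w * c3) / N * c1).
    { apply (Rmult_eq_reg_r N); [| exact HN].
      transitivity ((x * c1 + y * c2 + w * c3) * c1
         + c2 * (x * c2 - y * c1) - c3 * (w * c1 - x * c3)); [unfold N; ring|].
      rewrite E2, E3; field; exact HN. }
    assert (Ey : y = (x * c1 + y * c2 + w * c3) / N * c2).
    { apply (Rmult_eq_reg_r N); [| exact HN].
      transitivity ((x * c1 + y * c2 + w * c3) * c2
         + c3 * (y * c3 - w * c2) - c1 * (x * c2 - y * c1)); [unfold N; ring|].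
      rewrite E1, E3; field; exact HN. }
    assert (Ew : w = (x * c1 + y * c2 + w * c3) / N * c3).
    { apply (Rmult_eq_reg_r N); [| exact HN].
      transitivity ((x * c1 + y * c2 + w * c3) * c3
         + c1 * (w * c1 - x * c3) - c2 * (y * c3 - w * c2)); [unfold N; ring|].
      rewrite E1, E2; field; exact HN. }
    repeat split; try assumption.
    intros K; rewrite K in Ex, Ey, Ew; apply H0; repeat f_equal; lra. }
  destruct (P x y w G1 G2 HG) as (k & Hk & -> & -> & ->).
  destruct (P x' y' w' G1' G2' HG') as (k' & Hk' & -> & -> & ->).
  exists (k / k'); repeat split; try (field; assumption).
  apply Rmult_integral_contrapositive; split; [| apply Rinv_neq_0_compat]; assumption.
Qed.

Lemma incident_scale (L X Y : triple) :
  proportional X Y -> incident L Y -> incident L X.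
Proof.
  destruct L as [[l m] n], X as [[x y] w], Y as [[x' y'] w']; simpl.
  intros (k & Hk & -> & -> & ->) H.
  transitivity (k * (l * x' + m * y' + n * w')); [ring | rewrite H; ring].
Qed.

Lemma sum_sq_eq_0 (x y : R) : x ^ 2 + y ^ 2 = 0 -> x = 0 /\ y = 0.
Proof. intros H; apply Rplus_sqr_eq_0; unfold Rsqr; lra. Qed.

Lemma iso_form_vertex V U W P : iso_form V U W P V 1 = 0.
Proof. unfold iso_form, Im; simpl; ring. Qed.

(** The reflection exchanges the two sides at [V], so a reflected cevian through
    [U] comes from a cevian through [W].  The next lemma is the mirror case. *)
Lemma iso_form_at_U V U W P :
  iso_form V U W P U 1 = 0 -> ~ collinear V U W -> collinear W V P.
Proof.
  intros H Hc.
  assert (E : iso_form V U W P U 1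
    = ((fst U - fst V) ^ 2 + (snd U - snd V) ^ 2)
      * ((snd W - snd V) * (fst P - fst V) - (fst W - fst V) * (snd P - snd V))).
  { unfold iso_form, Im; simpl; ring. }
  rewrite E in H; apply Rmult_integral in H as [H | H].
  - exfalso; apply Hc; unfold collinear.
    apply sum_sq_eq_0 in H as [E1 E2]; rewrite E1, E2; ring.
  - unfold collinear; lra.
Qed.

Lemma iso_form_at_W V U W P :
  iso_form V U W P W 1 = 0 -> ~ collinear V U W -> collinear V U P.
Proof.
  intros H Hc.
  assert (E : iso_form V U W P W 1
    = ((fst W - fst V) ^ 2 + (snd W - snd V) ^ 2)
      * - ((fst U - fst V) * (snd P - snd V) - (snd U - snd V) * (fst P - fst V))).
  { unfold iso_form, Im; simpl; ring. }
  rewrite E in H; apply Rmult_integral in H as [H | H].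
  - exfalso; apply Hc; unfold collinear.
    apply sum_sq_eq_0 in H as [E1 E2]; rewrite E1, E2; ring.
  - unfold collinear; lra.
Qed.

(** * The locus of the isogonal conjugate is a punctured line *)

(** The point at infinity of the locus is [- i gP_dir], so this is a normal
    vector of its line in squashed coordinates. *)
Definition gP_dir (al ga p : C) : C := (p - al + Cconj ga * Cconj p)%C.

Lemma gP_coord_split al ga p r :
  gP_coord al ga p r
  = (fst r * (- Ci * gP_dir al ga p)
     + snd r * (Cconj ga * Cconj p - (p - al)))%C.
Proof. unfold gP_coord, gP_dir; apply C_eq; simpl; ring. Qed.

Lemma triple_eq (x y w x' y' w' : R) :
  x = x' -> y = y' -> w = w' -> (x, y, w) = (x', y', w') :> triple.
Proof. intros -> -> ->; reflexivity. Qed.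

Lemma triple_scale (k x y w x' y' w' : R) :
  (x, y, w) = (k * x', k * y', k * w') :> triple -> k <> 0 ->
  proportional (x, y, w) (x', y', w').
Proof. intros E Hk; injection E as -> -> ->; exists k; auto. Qed.

Lemma proportional_sym X Y : proportional X Y -> proportional Y X.
Proof.
  destruct X as [[x y] w], Y as [[x' y'] w']; intros (k & Hk & -> & -> & ->).
  exists (/ k); repeat split; try (field; exact Hk).
  apply Rinv_neq_0_compat; exact Hk.
Qed.

Lemma proportional_trans X Y Z :
  proportional X Y -> proportional Y Z -> proportional X Z.
Proof.
  destruct X as [[x y] w], Y as [[x' y'] w'], Z as [[x2 y2] w2].
  intros (k & Hk & -> & -> & ->) (k' & Hk' & -> & -> & ->).
  exists (k * k'); repeat split; try ring.
  apply Rmult_integral_contrapositive; auto.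
Qed.

(** [gP_hom] is injective on unit numbers up to sign, and the sign of the square
    root [r] of [p la] is immaterial: the locus is parametrised by [la]. *)
Lemma gP_hom_proportional a b al ga p r r' :
  0 < a -> 0 < b -> gP_dir al ga p <> 0%C -> on_unit r -> on_unit r' ->
  proportional (gP_hom a b al ga p r) (gP_hom a b al ga p r') <-> (r * r = r' * r')%C.
Proof.
  intros Ha Hb Hd Hr Hr'; split.
  - intros (k & Hk & E1 & E2 & E3).
    assert (K2 : snd r = k * snd r') by lra.
    assert (E : (gP_coord al ga p r = k * gP_coord al ga p r')%C).
    { apply (stretch_inj a b); auto; apply C_eq; [rewrite E1 | rewrite E2];
      simpl; ring. }
    rewrite !gP_coord_split, K2 in E.
    assert (K1 : RtoC (fst r - k * fst r') = 0%C).
    { destruct (C_mult_eq_0 (RtoC (fst r - k * fst r')) (- Ci * gP_dir al ga p))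
        as [K | K].
      - apply Ceq_minus in E; rewrite <- E, RtoC_minus, !RtoC_mult; ring.
      - exact K.
      - exfalso; apply C_mult_eq_0 in K as [K | K]; [| contradiction].
        apply (f_equal snd) in K; simpl in K; lra. }
    apply RtoC_inj in K1.
    assert (K : (r = k * r')%C) by (apply C_eq; simpl; lra).
    apply on_unit_sqr in Hr; apply on_unit_sqr in Hr'.
    assert (k * k = 1).
    { replace (fst r) with (k * fst r') in Hr by lra; rewrite K2 in Hr.
      transitivity (k ^ 2 * (fst r' ^ 2 + snd r' ^ 2)); [rewrite Hr'; ring | lra]. }
    rewrite K; transitivity (RtoC (k * k) * (r' * r'))%C;
      [rewrite RtoC_mult; ring | rewrite H; ring].
  - intros E.
    assert (K : (r - r')%C = 0%C \/ (r + r')%C = 0%C).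
    { apply C_mult_eq_0; apply Ceq_minus in E; rewrite <- E; ring. }
    destruct K as [K | K].
    + apply Ceq_minus in K; subst r'; unfold gP_hom; apply (triple_scale 1); [|lra].
      apply triple_eq; ring.
    + assert (r = (- r')%C) as -> by (apply Ceq_minus; rewrite <- K; ring).
      unfold gP_hom; apply (triple_scale (- 1)); [|lra].
      apply triple_eq; simpl; ring.
Qed.

Lemma gP_hom_neq_0 a b al ga p r :
  0 < a -> 0 < b -> gP_dir al ga p <> 0%C -> on_unit r ->
  gP_hom a b al ga p r <> (0, 0, 0).
Proof.
  intros Ha Hb Hd Hr E; unfold gP_hom in E; injection E as E1 E2 E3.
  apply on_unit_sqr in Hr.
  assert (K2 : snd r = 0) by lra.
  assert (E : gP_coord al ga p r = 0%C).
  { apply (stretch_inj a b); auto; unfold stretch; simpl; apply C_eq; simpl in *; lra. }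
  rewrite gP_coord_split, K2 in E.
  destruct (C_mult_eq_0 (RtoC (fst r)) (- Ci * gP_dir al ga p)) as [K | K].
  - rewrite <- E; ring.
  - apply RtoC_inj in K; rewrite K, K2 in Hr; lra.
  - apply C_mult_eq_0 in K as [K | K]; [| contradiction].
    apply (f_equal snd) in K; simpl in K; lra.
Qed.

(** The closed form lies on the three reflected cevians.  Conversely the cevians
    at two vertices already determine the point, because [P] is on no side
    line: neither of them is the side line of these two vertices. *)
Lemma isogonal_conjugate_gP a b al be u v w p r G :
  0 < a -> 0 < b -> a <> b -> on_unit p -> on_unit r ->
  blaschke_triangle al be u v w -> (r * r = p * (u * v * w))%C ->
  gP_dir al (gamma a b be) p <> 0%C ->
  isogonal_conjugate (stretch a b u) (stretch a b v) (stretch a b w) (stretch a b p) G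
  <-> (p <> u /\ p <> v /\ p <> w) /\ G <> (0, 0, 0) /\
      proportional G (gP_hom a b al (gamma a b be) p r).
Proof.
  intros Ha Hb Hab Hp Hr HB Hl Hd.
  pose proof HB as ((Hu & Hv & Hw) & (N12 & N23 & N31) & E1).
  pose proof (unit_neq_0 u Hu); pose proof (unit_neq_0 v Hv);
  pose proof (unit_neq_0 w Hw); pose proof (unit_neq_0 r Hr);
  pose proof (unit_neq_0 p Hp).
  assert (Ep : p = (r * r / (u * v * w))%C) by (rewrite Hl; field; auto).
  assert (ES : gP_coord al (gamma a b be) p r
     = (- Ci * Cconj r * (p - (u + v + w) + 2 * axis_ratio a b * (u * v * w)))%C).
  { unfold gP_coord, gamma; rewrite Cminus_conj, Cmult_conj, !Cconj_R, E1.
    rewrite (unit_conj p Hp), (unit_conj r Hr).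
    apply Ceq_minus.
    transitivity (- Ci * (2 * axis_ratio a b - Cconj be) / (p * r) * (r * r - p * (u * v * w)))%C.
    - field; auto.
    - rewrite Hl; ring. }
  assert (NC : forall x y z, on_unit x -> on_unit y -> on_unit z ->
     x <> y -> y <> z -> z <> x ->
     ~ collinear (stretch a b x) (stretch a b y) (stretch a b z)).
  { intros x y z Hx Hy Hz n1 n2 n3 K.
    apply collinear_units in K; try assumption; try lra.
    destruct K as [K | [K | K]]; auto. }
  set (S := gP_hom a b al (gamma a b be) p r).
  assert (HS : S <> (0, 0, 0)) by (apply gP_hom_neq_0; assumption).
  assert (I1 : incident (reflected_cevian (stretch a b u) (stretch a b v) (stretch a b w) (stretch a b p)) S).
  { unfold S, gP_hom; rewrite incident_reflected, ES by auto.
    apply iso_form_gP; assumption. }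
  assert (I2 : incident (reflected_cevian (stretch a b v) (stretch a b w) (stretch a b u) (stretch a b p)) S).
  { unfold S, gP_hom; rewrite incident_reflected, ES by auto.
    replace (u + v + w)%C with (v + w + u)%C by ring.
    replace (u * v * w)%C with (v * w * u)%C by ring.
    apply iso_form_gP; try assumption; rewrite Ep; field; auto. }
  assert (I3 : incident (reflected_cevian (stretch a b w) (stretch a b u) (stretch a b v) (stretch a b p)) S).
  { unfold S, gP_hom; rewrite incident_reflected, ES by auto.
    replace (u + v + w)%C with (w + u + v)%C by ring.
    replace (u * v * w)%C with (w * u * v)%C by ring.
    apply iso_form_gP; try assumption; rewrite Ep; field; auto. }
  split.
  - intros (M1 & M2 & M3 & HG & J1 & J2 & J3).
    split; [| split; [exact HG |]].
    { repeat split; intros <-; [apply M1 | apply M1 | apply M2]; unfold collinear; ring. }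
    pose proof (incident_reflected (stretch a b u) (stretch a b v) (stretch a b w) (stretch a b p)) as R1.
    pose proof (incident_reflected (stretch a b v) (stretch a b w) (stretch a b u) (stretch a b p)) as R2.
    refine (meet_unique _ _ (hom (stretch a b u)) (hom (stretch a b v)) _ _ _ _ _ _ J1 J2 I1 I2 HG HS);
      unfold hom.
    + apply R1; auto; apply iso_form_vertex.
    + intros K; apply R1 in K; auto; apply M3.
      apply (iso_form_at_U _ _ _ _ K); auto.
    + apply R2; auto; apply iso_form_vertex.
    + intros K; apply R2 in K; auto; apply M2.
      apply (iso_form_at_W _ _ _ _ K); auto.
  - intros ((n1 & n2 & n3) & HG & K).
    repeat split; try (apply NC; auto); try exact HG;
      eapply incident_scale; eassumption.
Qed.

(** The set where [(p - al + conj ga la) / (p la - 1)] has [|la| = 1]: solving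
    for [la] and equating moduli, the terms in [|G|^2] cancel because
    [|p| = 1]. *)
Definition locus_line (a b : R) (al ga p : C) : triple :=
  (2 * fst (gP_dir al ga p) / a, 2 * snd (gP_dir al ga p) / b,
   - (2 * (fst p * fst al + snd p * snd al)
      + (fst ga ^ 2 + snd ga ^ 2) - 1 - (fst al ^ 2 + snd al ^ 2))).

Lemma incident_locus_gP a b al ga p r :
  0 < a -> 0 < b -> on_unit p -> incident (locus_line a b al ga p) (gP_hom a b al ga p r).
Proof.
  intros Ha Hb Hp; apply on_unit_sqr in Hp.
  assert (E : fst p ^ 2 = 1 - snd p ^ 2) by lra.
  unfold incident, locus_line, gP_hom; simpl.
  field_simplify_eq; [| lra]; ring [E].
Qed.

(** [gP_hom] is real-linear in [r] and its values at [r = 1], [r = i] span the points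
    of the line; a unit [r] is the normalised coefficient vector. *)
Lemma incident_locus_inv a b al ga p X :
  0 < a -> 0 < b -> on_unit p -> gP_dir al ga p <> 0%C ->
  X <> (0, 0, 0) -> incident (locus_line a b al ga p) X ->
  exists r : C, on_unit r /\ proportional X (gP_hom a b al ga p r).
Proof.
  intros Ha Hb Hp Hd; destruct X as [[x y] w]; intros HX HI.
  set (d := gP_dir al ga p) in *.
  set (e := (Cconj ga * Cconj p - (p - al))%C).
  assert (Hn : 0 < fst d ^ 2 + snd d ^ 2).
  { destruct (Req_dec (fst d) 0); [| nra].
    destruct (Req_dec (snd d) 0); [| nra].
    exfalso; apply Hd, C_eq; assumption. }
  set (n := fst d ^ 2 + snd d ^ 2) in *.
  set (z := (squash a b (x, y) - (w / 2)%R * e)%C).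
  assert (Hz : fst d * fst z + snd d * snd z = 0).
  { assert (H0 : incident (locus_line a b al ga p) (gP_hom a b al ga p (0, w / 2)))
      by (apply incident_locus_gP; assumption).
    unfold incident, locus_line, gP_hom in HI, H0.
    rewrite gP_coord_split in H0; fold d e in HI, H0.
    unfold z, squash, stretch in *; clear -HI H0 Ha Hb; clearbody d e.
    apply (Rmult_eq_reg_l 2); [| lra].
    rewrite Rmult_0_r, <- (Rminus_diag 0).
    rewrite <- HI at 1; rewrite <- H0.
    simpl; field; lra. }
  set (c := - (fst d * snd z - snd d * fst z) / n).
  assert (Ez : z = (c * (- Ci * d))%C).
  { assert (E1 : fst z * n = snd d * (- (fst d * snd z - snd d * fst z))
        + fst d * (fst d * fst z + snd d * snd z)) by (unfold n; ring).
    assert (E2 : snd z * n = - fst d * (- (fst d * snd z - snd d * fst z))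
        + snd d * (fst d * fst z + snd d * snd z)) by (unfold n; ring).
    rewrite Hz in E1, E2.
    apply C_eq; apply (Rmult_eq_reg_r n); try lra; rewrite ?E1, ?E2;
      unfold c; simpl; field; lra. }
  assert (EX : squash a b (x, y) = (c * (- Ci * d) + (w / 2)%R * e)%C).
  { rewrite <- Ez; unfold z; ring. }
  set (N := sqrt (c ^ 2 + (w / 2) ^ 2)).
  assert (HN : 0 < c ^ 2 + (w / 2) ^ 2).
  { destruct (Req_dec c 0) as [K1 |]; [| nra].
    destruct (Req_dec w 0) as [K2 |]; [| nra].
    exfalso; apply HX; rewrite K1, K2 in EX.
    pose proof (f_equal fst EX) as F1; pose proof (f_equal snd EX) as F2.
    simpl in F1, F2.
    apply triple_eq; [| | exact K2].
    - transitivity (a * (x / a)); [field; lra | rewrite F1; field].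
    - transitivity (b * (y / b)); [field; lra | rewrite F2; field]. }
  assert (HN0 : 0 < N) by (apply sqrt_lt_R0; exact HN).
  assert (HN2 : N * N = c ^ 2 + (w / 2) ^ 2) by (apply sqrt_sqrt; lra).
  exists (c / N, w / 2 / N); split.
  - apply on_unit_sqr; simpl fst; simpl snd.
    transitivity ((c ^ 2 + (w / 2) ^ 2) / (N * N)); [field; lra|].
    rewrite HN2; apply Rdiv_diag; lra.
  - unfold gP_hom; rewrite gP_coord_split; fold d e; apply (triple_scale N); [| lra].
    pose proof (f_equal fst EX) as F1; pose proof (f_equal snd EX) as F2.
    clearbody d e; simpl in F1, F2.
    apply triple_eq; simpl.
    + transitivity (a * (x / a)); [field; lra | rewrite F1; field; lra].
    + transitivity (b * (y / b)); [field; lra | rewrite F2; field; lra].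
    + field; lra.
Qed.

(** Triangles correspond to unit numbers [la], points of the line to unit numbers
    [r] up to sign, and [r^2 = p la] matches the two; only the triangle with a
    vertex at [p] has no isogonal conjugate. *)
Lemma locus_punctured a b Q (p : C) :
  0 < a -> 0 < b -> a <> b -> 0 < adj33 Q -> nested Q a b ->
  admits_porism (std_ellipse a b) Q -> on_unit p ->
  let al := foci_sum a b Q in
  let ga := gamma a b (foci_prod a b Q) in
  gP_dir al ga p <> 0%C /\
  punctured_line (locus_line a b al ga p)
    (locus_gP (std_ellipse a b) Q (stretch a b p)).
Proof.
  intros Ha Hb Hab HQ Hn Hp Hpu al ga.
  assert (Hd : gP_dir al ga p <> 0%C).
  { destruct (poncelet_of_product a b Q Ha Hb HQ Hn Hp (Cconj p) (unit_Cconj p Hpu))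
      as (u & v & w & _ & HB & Hl).
    exact (gP_dir_neq_0 a b _ _ p u v w Ha Hb Hab Hpu HB Hl). }
  split; [exact Hd|]; split.
  { unfold locus_line; revert Hd; generalize (gP_dir al ga p); intros d Hd E.
    injection E as E1 E2; apply Hd; apply C_eq; cbn [fst snd RtoC].
    - transitivity (a / 2 * (2 * fst d / a)); [field; lra | rewrite E1; ring].
    - transitivity (b / 2 * (2 * snd d / b)); [field; lra | rewrite E2; ring]. }
  (* [l0] is the product of the triangles with a vertex at [p]; its point is the
     puncture. *)
  destruct (poncelet_at_vertex a b Q Ha Hb HQ Hn Hp p Hpu)
    as (HM & v0 & w0 & _ & HB0).
  set (l0 := (p * v0 * w0)%C) in *.
  assert (Hl0 : on_unit l0).
  { destruct HB0 as ((_ & Hv0 & Hw0) & _); unfold l0.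
    repeat apply unit_mult; assumption. }
  assert (V : forall u v w, blaschke_triangle al (foci_prod a b Q) u v w ->
     (u * v * w = l0)%C <-> (p = u \/ p = v \/ p = w)).
  { intros u v w HB.
    rewrite <- (blaschke_vertex _ _ _ _ _ p HB).
    pose proof (proj2 (blaschke_vertex _ _ _ _ _ p HB0) (or_introl eq_refl)) as F.
    fold al l0 in F; rewrite F.
    split; [intros ->; reflexivity|].
    intros E; apply Ceq_minus.
    destruct (C_mult_eq_0 (u * v * w - l0)%C
      (blaschke_den (Cconj al) (Cconj (foci_prod a b Q)) p)) as [K | K];
      [| exact K | contradiction].
    apply Ceq_minus in E; fold al in E.
    transitivity (- 0)%C; [rewrite <- E | ]; ring. }
  destruct (unit_sqrt (p * l0)%C (unit_mult _ _ Hpu Hl0)) as (r0 & Hr0 & E0).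
  exists (gP_hom a b al ga p r0).
  split; [apply gP_hom_neq_0; assumption|].
  split; [apply incident_locus_gP; assumption|].
  pose proof (unit_neq_0 p Hpu) as Hp0.
  intros X HX; split.
  - intros (V1 & V2 & V3 & HT & HI).
    destruct (poncelet_blaschke a b Q Ha Hb HQ Hn _ _ _ HT)
      as (u & v & w & -> & -> & -> & HB & _).
    destruct (unit_sqrt (p * (u * v * w))%C) as (r & Hr & Er).
    { destruct HB as ((Hu & Hv & Hw) & _); repeat apply unit_mult; assumption. }
    apply (isogonal_conjugate_gP a b al _ u v w p r X Ha Hb Hab Hpu Hr HB Er Hd) in HI.
    destruct HI as ((n1 & n2 & n3) & _ & HX1); fold ga in HX1.
    split.
    + apply (incident_scale _ _ _ HX1), incident_locus_gP; assumption.
    + intros K.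
      pose proof (proportional_trans _ _ _ (proportional_sym _ _ HX1) K) as K'.
      apply gP_hom_proportional in K'; try assumption.
      assert (El : (u * v * w = l0)%C).
      { transitivity (/ p * (r * r))%C; [rewrite Er; field; exact Hp0|].
        rewrite K', E0; field; exact Hp0. }
      apply V in El; [| exact HB]; tauto.
  - intros (HI & HX0).
    destruct (incident_locus_inv a b al ga p X Ha Hb Hpu Hd HX HI) as (r & Hr & HXr).
    destruct (poncelet_of_product a b Q Ha Hb HQ Hn Hp (r * r * Cconj p)%C)
      as (u & v & w & HT & HB & El).
    { repeat apply unit_mult; auto; apply unit_Cconj; exact Hpu. }
    exists (stretch a b u), (stretch a b v), (stretch a b w); split; [exact HT|].
    assert (Er : (r * r = p * (u * v * w))%C)
      by (rewrite El, (unit_conj p Hpu); field; exact Hp0).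
    apply (isogonal_conjugate_gP a b al _ u v w p r X Ha Hb Hab Hpu Hr HB Er Hd).
    split; [| split; assumption].
    assert (NV : ~ (p = u \/ p = v \/ p = w)).
    { intros K; apply (V _ _ _ HB) in K; apply HX0.
      apply (proportional_trans _ _ _ HXr), gP_hom_proportional; try assumption.
      rewrite Er, K, E0; reflexivity. }
    tauto.
Qed.

(** * Centre, determinant and axis directions of a conic *)

Definition center (Q : conic) : point := (adj13 Q / adj33 Q, adj23 Q / adj33 Q).

Lemma is_center_center Q : 0 < adj33 Q -> is_center Q (center Q).
Proof.
  intros H; assert (adj33 Q <> 0) by lra.
  split; [exact H0|]; unfold center; cbn [fst snd]; split;
    apply (Rmult_eq_reg_r (adj33 Q)); try assumption; field_simplify; try assumption;
    unfold adj13, adj23, adj33; ring.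
Qed.

Lemma conic_eval_reflected Q X :
  0 < adj33 Q ->
  conic_eval Q (psub (pscale 2 (center Q)) X) = conic_eval Q X.
Proof.
  intros H.
  pose proof (is_center_center Q H) as (_ & H1 & H2).
  set (c := center Q) in *.
  transitivity (conic_eval Q X
    + 2 * (fst c - fst X) * (2 * qxx Q * fst c + qxy Q * snd c + qx Q)
    + 2 * (snd c - snd X) * (qxy Q * fst c + 2 * qyy Q * snd c + qy Q)).
  - unfold conic_eval, psub, pscale; cbn [fst snd]; ring.
  - rewrite H1, H2; ring.
Qed.

(** The centre of the caustic is the midpoint of two of its points, which are
    inside the outer ellipse. *)
Lemma foci_sum_small a b Q :
  0 < a -> 0 < b -> is_ellipse Q -> nested Q a b ->
  fst (foci_sum a b Q) ^ 2 + snd (foci_sum a b Q) ^ 2 < 4.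
Proof.
  intros Ha Hb (HQ & X & _ & _ & HX & _) Hn.
  change (0 < adj33 Q) in HQ.
  assert (HX' : on_conic Q (psub (pscale 2 (center Q)) X))
    by (red; rewrite conic_eval_reflected; assumption).
  apply Hn in HX; apply Hn in HX'.
  replace (fst (foci_sum a b Q))
    with (fst X / a + fst (psub (pscale 2 (center Q)) X) / a)
    by (unfold foci_sum, center; simpl; field; lra).
  replace (snd (foci_sum a b Q))
    with (snd X / b + snd (psub (pscale 2 (center Q)) X) / b)
    by (unfold foci_sum, center; simpl; field; lra).
  set (x := fst X / a) in *; set (y := snd X / b) in *.
  set (x' := fst (psub _ _) / a) in *; set (y' := snd (psub _ _) / b) in *.
  pose proof (pow2_ge_0 (x - x')); pose proof (pow2_ge_0 (y - y')); lra.
Qed.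

(** Completing squares writes a multiple of the equation as a positive definite
    form minus a multiple of the determinant; a zero determinant would leave a
    single point. *)
Lemma conic_det_neq_0 Q : is_ellipse Q -> conic_det Q <> 0.
Proof.
  intros (HQ & X & Y & HXY & HX & HY) E; change (0 < adj33 Q) in HQ.
  assert (U : forall Z, on_conic Q Z ->
     2 * qxx Q * fst Z + qxy Q * snd Z + qx Q = 0 /\ adj33 Q * snd Z = adj23 Q).
  { intros Z HZ.
    assert (K : adj33 Q * (2 * qxx Q * fst Z + qxy Q * snd Z + qx Q) ^ 2
       + (adj33 Q * snd Z - adj23 Q) ^ 2 = 0).
    { transitivity (4 * qxx Q * adj33 Q * conic_eval Q Z - 4 * qxx Q * conic_det Q).
      - unfold adj33, adj23, conic_eval, conic_det; ring.
      - rewrite HZ, E; ring. }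
    set (s := 2 * qxx Q * fst Z + qxy Q * snd Z + qx Q) in *.
    set (t := adj33 Q * snd Z - adj23 Q) in *.
    pose proof (pow2_ge_0 s); pose proof (pow2_ge_0 t).
    assert (0 <= adj33 Q * s ^ 2) by (apply Rmult_le_pos; lra).
    assert (Es : s ^ 2 = 0) by (apply (Rmult_eq_reg_l (adj33 Q)); lra).
    destruct (sum_sq_eq_0 s t) as [Ks Kt]; [lra|].
    split; [exact Ks | unfold t in Kt; lra]. }
  destruct (U X HX) as [X1 X2]; destruct (U Y HY) as [Y1 Y2].
  apply HXY.
  assert (Es : snd X = snd Y) by (apply (Rmult_eq_reg_l (adj33 Q)); lra).
  apply C_eq; [| exact Es].
  rewrite Es in X1.
  assert (qxx Q <> 0) by (intros K; unfold adj33 in HQ; rewrite K in HQ; nra).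
  apply (Rmult_eq_reg_l (2 * qxx Q)); lra.
Qed.

Lemma axis_direction_exists Q : exists D, axis_direction Q D.
Proof.
  destruct (Req_dec (qxy Q) 0) as [E | E].
  - exists (1, 0); split; [intros K; injection K as K; lra|].
    exists (qxx Q); simpl; rewrite E; split; field.
  - set (p := qxx Q); set (r := qyy Q); set (q := qxy Q) in *.
    set (h := sqrt ((p - r) ^ 2 + q ^ 2)).
    assert (Hh : h * h = (p - r) ^ 2 + q ^ 2) by 
      (apply sqrt_sqrt, Rplus_le_le_0_compat; apply pow2_ge_0).
    (* [h] is the square root of the discriminant of the characteristic
       polynomial. *)
    exists (q / 2, (r - p + h) / 2); split.
    + intros K; injection K as K _; lra.
    + exists ((p + r + h) / 2); cbn [fst snd]; fold p q r; split; [field|].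
      apply (Rmult_eq_reg_l 4); [|lra].
      transitivity ((h * h - (p - r) ^ 2) + 2 * r * (r - p + h));
        [rewrite Hh |]; field.
Qed.

Lemma axis_direction_pencil Q Q' s t D :
  s <> 0 ->
  qxx Q' = s * qxx Q + t -> qxy Q' = s * qxy Q -> qyy Q' = s * qyy Q + t ->
  axis_direction Q' D <-> axis_direction Q D.
Proof.
  intros Hs E1 E2 E3; split; intros (HD & mu & H1 & H2); split; try exact HD.
  - exists ((mu - t) / s); rewrite E1, E2, E3 in *.
    split; apply (Rmult_eq_reg_l s); try assumption; field_simplify; lra.
  - exists (s * mu + t); rewrite E1, E2, E3; split.
    + transitivity (s * (qxx Q * fst D + qxy Q / 2 * snd D) + t * fst D);
        [field | rewrite H1; ring].
    + transitivity (s * (qxy Q / 2 * fst D + qyy Q * snd D) + t * snd D);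
        [field | rewrite H2; ring].
Qed.

(** * The envelope of the loci *)

(** The conic [|W|^2 = w^2], where [Re (p W) = w] is the line of [p]; [env_re],
    [env_im] and [env_rhs] are the real and imaginary part of [W] and [w]. *)
Definition envelope_conic (a b : R) (al ga : C) : conic :=
  let n := fst ga ^ 2 + snd ga ^ 2 - 1 - (fst al ^ 2 + snd al ^ 2) in
  Conic
    (4 * ((1 + fst ga) ^ 2 + snd ga ^ 2 - fst al ^ 2) / a ^ 2)
    (- 8 * (2 * snd ga + fst al * snd al) / (a * b))
    (4 * ((1 - fst ga) ^ 2 + snd ga ^ 2 - snd al ^ 2) / b ^ 2)
    (- 4 * (2 * (1 + fst ga) * fst al - 2 * snd ga * snd al + fst al * n) / a)
    (- 4 * (2 * (1 - fst ga) * snd al - 2 * snd ga * fst al + snd al * n) / b)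
    (4 * (fst al ^ 2 + snd al ^ 2) - n ^ 2).

Definition env_re (a b : R) (al ga : C) (X : point) : R :=
  2 * ((1 + fst ga) * (fst X / a) - snd ga * (snd X / b) - fst al).
Definition env_im (a b : R) (al ga : C) (X : point) : R :=
  2 * (snd ga * (fst X / a) - (1 - fst ga) * (snd X / b) + snd al).
Definition env_rhs (a b : R) (al ga : C) (X : point) : R :=
  2 * (fst al * (fst X / a) + snd al * (snd X / b))
  + (fst ga ^ 2 + snd ga ^ 2 - 1 - (fst al ^ 2 + snd al ^ 2)).

Lemma envelope_conic_eval a b al ga X :
  a <> 0 -> b <> 0 ->
  conic_eval (envelope_conic a b al ga) X
  = env_re a b al ga X ^ 2 + env_im a b al ga X ^ 2 - env_rhs a b al ga X ^ 2.
Proof.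
  intros Ha Hb; unfold conic_eval, envelope_conic, env_re, env_im, env_rhs.
  cbn [qxx qxy qyy qx qy q1]; field; auto.
Qed.

(** The two equations say that [p (w1 + i w2)] has real part [w0] and imaginary
    part zero; a unit [p] turns [w1 + i w2] into [w0] iff their moduli agree. *)
Lemma rotating_line_envelope (w1 w2 w0 : R) :
  w1 ^ 2 + w2 ^ 2 - w0 ^ 2 = 0 <->
  exists t, cos t * w1 - sin t * w2 - w0 = 0 /\ - sin t * w1 - cos t * w2 = 0.
Proof.
  split.
  - intros H; destruct (Req_dec w0 0) as [K | K].
    + rewrite K in *; destruct (sum_sq_eq_0 w1 w2) as [-> ->]; [lra|].
      exists 0; split; ring.
    + destruct (unit_angle (w1 / w0, - w2 / w0)) as [t Ht].
      { apply on_unit_sqr; cbn [fst snd].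
        transitivity ((w1 ^ 2 + w2 ^ 2) / w0 ^ 2); [field; exact K|].
        replace (w1 ^ 2 + w2 ^ 2) with (w0 ^ 2) by lra; field; exact K. }
      injection Ht as H1 H2; exists t; rewrite <- H1, <- H2; split.
      * transitivity ((w1 ^ 2 + w2 ^ 2 - w0 ^ 2) / w0); [field; exact K | rewrite H; field; exact K].
      * field; exact K.
  - intros (t & H1 & H2).
    pose proof (proj1 (on_unit_sqr _) (unit_cis t)) as Ht; cbn [fst snd] in Ht.
    transitivity ((w1 ^ 2 + w2 ^ 2) * (cos t ^ 2 + sin t ^ 2) - w0 ^ 2);
      [rewrite Ht; ring|].
    transitivity ((cos t * w1 - sin t * w2 - w0) * (cos t * w1 - sin t * w2 + w0)
      + (- sin t * w1 - cos t * w2) ^ 2); [ring | rewrite H1, H2; ring].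
Qed.

Lemma is_envelope_conic a b al ga (F : R -> triple -> Prop) :
  0 < a -> 0 < b ->
  (forall t, F t (locus_line a b al ga (cos t, sin t))) ->
  is_envelope F (on_conic (envelope_conic a b al ga)).
Proof.
  intros Ha Hb HF.
  pose (l := fun t => 2 * ((1 + fst ga) * cos t - snd ga * sin t - fst al) / a).
  pose (m := fun t => 2 * ((1 - fst ga) * sin t - snd ga * cos t - snd al) / b).
  pose (n := fun t => - (2 * (cos t * fst al + sin t * snd al)
      + (fst ga ^ 2 + snd ga ^ 2) - 1 - (fst al ^ 2 + snd al ^ 2))).
  assert (Dl : forall t, is_derive l t (2 * (- (1 + fst ga) * sin t - snd ga * cos t) / a))
    by (intros t; unfold l; auto_derive; [trivial | field; lra]).
  assert (Dm : forall t, is_derive m t (2 * ((1 - fst ga) * cos t + snd ga * sin t) / b))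
    by (intros t; unfold m; auto_derive; [trivial | field; lra]).
  assert (Dn : forall t, is_derive n t (- (2 * (- sin t * fst al + cos t * snd al))))
    by (intros t; unfold n; auto_derive; [trivial | field; lra]).
  exists l, m, n; split; [| split].
  - intros t; repeat split; eexists; eauto.
  - intros t; replace (l t, m t, n t) with (locus_line a b al ga (cos t, sin t));
      [apply HF|].
    unfold locus_line, gP_dir, l, m, n; apply triple_eq; simpl; field; lra.
  - intros X; unfold on_conic; rewrite envelope_conic_eval by lra.
    rewrite rotating_line_envelope.
    split; intros (t & H1 & H2); exists t.
    + rewrite (is_derive_unique _ _ _ (Dl t)), (is_derive_unique _ _ _ (Dm t)),
        (is_derive_unique _ _ _ (Dn t)).
      split; [rewrite <- H1 | rewrite <- H2];
        unfold l, m, n, env_re, env_im, env_rhs; field; lra.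
    + rewrite (is_derive_unique _ _ _ (Dl t)), (is_derive_unique _ _ _ (Dm t)),
        (is_derive_unique _ _ _ (Dn t)) in H2.
      split; [rewrite <- H1 | rewrite <- H2];
        unfold l, m, n, env_re, env_im, env_rhs; field; lra.
Qed.

(** [(|ga|^2 - 1)^2 - |al ga - conj al|^2]; this one number governs the
    determinant of the quadratic part, the value at the centre and so the
    determinant of the envelope. *)
Definition env_disc (al ga : C) : R :=
  (fst ga ^ 2 + snd ga ^ 2 - 1) ^ 2
  - ((fst al * fst ga - snd al * snd ga - fst al) ^ 2
     + (fst al * snd ga + snd al * fst ga + snd al) ^ 2).

(** [gP_dir] is real-linear in [p], up to a translation, with determinant
    [1 - |ga|^2].  If that is nonzero, [gP_dir] has one zero in the plane and
    [env_disc = 0] puts it on the unit circle.  If it is zero, the image of the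
    plane is a real line, and a zero of [env_disc] makes the equation
    [gP_dir = 0] one for the real part of [p / h], where [h^2 = conj ga]; the
    bound on [al] makes this solvable on the unit circle. *)
Lemma env_disc_neq_0 al ga :
  fst al ^ 2 + snd al ^ 2 < 4 ->
  (forall p, on_unit p -> gP_dir al ga p <> 0%C) ->
  env_disc al ga <> 0.
Proof.
  intros Hal Hd E; unfold env_disc in E.
  set (n := fst ga ^ 2 + snd ga ^ 2 - 1) in *.
  destruct (Req_dec n 0) as [K | K].
  - assert (Ug : on_unit ga) by (apply on_unit_sqr; unfold n in K; lra).
    destruct (unit_sqrt _ (unit_Cconj _ Ug)) as (h & Hh & Eh).
    destruct (sum_sq_eq_0 (fst al * fst ga - snd al * snd ga - fst al)
      (fst al * snd ga + snd al * fst ga + snd al)) as [K1 K2];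
      [rewrite K in E; lra|].
    assert (EA : (Cconj al = al * ga)%C) by (apply C_eq; simpl; lra).
    assert (Hr : Cconj (al * Cconj h) = (al * Cconj h)%C).
    { rewrite Cmult_conj, Cconj_conj, EA.
      rewrite <- (Cconj_conj ga), <- Eh, Cmult_conj.
      transitivity (al * Cconj h * (h * Cconj h))%C; [ring|].
      rewrite Hh; ring. }
    set (x := fst (al * Cconj h)%C).
    assert (Hx : (al * Cconj h)%C = RtoC x).
    { apply C_eq; [reflexivity|].
      apply (f_equal snd) in Hr.
      change (- snd (al * Cconj h)%C = snd (al * Cconj h)%C) in Hr.
      change (snd (al * Cconj h)%C = 0); lra. }
    assert (Ea : al = (x * h)%C).
    { apply Ceq_minus; rewrite <- Hx.
      transitivity (al * (1 - h * Cconj h))%C; [ring | rewrite Hh; ring]. }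
    assert (Hx4 : x ^ 2 < 4).
    { apply on_unit_sqr in Hh.
      rewrite Ea in Hal; simpl fst in Hal; simpl snd in Hal.
      replace (x ^ 2) with (x ^ 2 * (fst h ^ 2 + snd h ^ 2)) by (rewrite Hh; ring).
      lra. }
    set (y := sqrt (1 - (x / 2) ^ 2)).
    assert (Hy : y * y = 1 - (x / 2) ^ 2) by (apply sqrt_sqrt; lra).
    pose (e := (x / 2, y) : C).
    assert (He : on_unit e) by (apply on_unit_sqr; unfold e; cbn [fst snd]; lra).
    assert (Ee : (e + Cconj e)%C = RtoC x) by (apply C_eq; simpl; field).
    apply (Hd (h * e)%C); [apply unit_mult; assumption|].
    unfold gP_dir; rewrite <- Eh, Cmult_conj, Ea, <- Ee.
    transitivity (h * Cconj e * (h * Cconj h - 1))%C; [ring|].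
    rewrite Hh; ring.
  - pose (z := ((fst al * fst ga - snd al * snd ga - fst al) / n,
                - (fst al * snd ga + snd al * fst ga + snd al) / n) : C).
    apply (Hd z).
    + apply on_unit_sqr; unfold z; cbn [fst snd].
      match type of E with _ - ?r = 0 => transitivity (r / n ^ 2) end;
        [field; exact K|].
      match type of E with _ - ?r = 0 => replace r with (n ^ 2) by lra end.
      field; exact K.
    + unfold gP_dir, z; apply C_eq; simpl; field_simplify_eq; try exact K;
        unfold n; ring.
Qed.

Lemma envelope_conic_nondegenerate a b al ga :
  a <> 0 -> b <> 0 -> env_disc al ga <> 0 ->
  nondegenerate (envelope_conic a b al ga).
Proof.
  intros Ha Hb HK E; apply HK.
  assert (F : conic_det (envelope_conic a b al ga) * (a ^ 2 * b ^ 2)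
              = - 64 * env_disc al ga ^ 2).
  { unfold conic_det, envelope_conic, env_disc; cbn [qxx qxy qyy qx qy q1].
    field; auto. }
  rewrite E in F; nra.
Qed.

Lemma envelope_conic_center a b al ga :
  a <> 0 -> b <> 0 -> env_disc al ga <> 0 ->
  is_center (envelope_conic a b al ga) (a * fst al / 2, b * snd al / 2).
Proof.
  intros Ha Hb HK; split; [| split].
  - intros E; apply HK.
    assert (F : (4 * qxx (envelope_conic a b al ga) * qyy (envelope_conic a b al ga)
       - qxy (envelope_conic a b al ga) ^ 2) * (a ^ 2 * b ^ 2) = 64 * env_disc al ga).
    { unfold envelope_conic, env_disc; cbn [qxx qxy qyy qx qy q1]; field; auto. }
    rewrite E in F; lra.
  - unfold envelope_conic; cbn [fst snd qxx qxy qyy qx qy q1]; field; auto.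
  - unfold envelope_conic; cbn [fst snd qxx qxy qyy qx qy q1]; field; auto.
Qed.

(** The closing relation removes [|be|^2] from the quadratic part of the
    envelope.  Up to a multiple of [x^2 + y^2], what remains involves the dual
    entries only through two by two minors of the adjugate, which are multiples
    of the entries of the caustic itself. *)
Lemma envelope_pencil a b Q :
  0 < a -> 0 < b -> a <> b -> is_ellipse Q ->
  let al := foci_sum a b Q in
  let be := foci_prod a b Q in
  1 + chord_mid a b Q + (fst be ^ 2 + snd be ^ 2) - (fst al ^ 2 + snd al ^ 2) = 0 ->
  let G := envelope_conic a b al (gamma a b be) in
  exists s t : R, s <> 0 /\
    qxx G = s * qxx Q + t /\ qxy G = s * qxy Q /\ qyy G = s * qyy Q + t.
Proof.
  intros Ha Hb Hab HQ al be HC G.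
  assert (H33 : adj33 Q <> 0) by (destruct HQ as [HQ _]; change (0 < adj33 Q) in HQ; lra).
  assert (Hab2 : a ^ 2 - b ^ 2 <> 0)
    by (replace (a ^ 2 - b ^ 2) with ((a - b) * (a + b)) by ring;
        apply Rmult_integral_contrapositive; lra).
  pose proof (conic_det_neq_0 Q HQ) as Hdet.
  set (s := - 64 * conic_det Q / (a ^ 2 * b ^ 2 * adj33 Q ^ 2)).
  exists s, (qxx G - s * qxx Q).
  set (k := axis_ratio a b).
  assert (G1 : fst (gamma a b be) = 2 * k - fst be)
    by (unfold gamma; fold k; simpl; ring).
  assert (G2 : snd (gamma a b be) = - snd be)
    by (unfold gamma; simpl; ring).
  assert (Hbe : fst be ^ 2 + snd be ^ 2
     = fst al ^ 2 + snd al ^ 2 - 1 - chord_mid a b Q) by lra.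
  assert (Exx : qxx G = 4 * (4 * k + 4 * k ^ 2 - 4 * k * fst be - 2 * fst be
                - chord_mid a b Q + snd al ^ 2) / a ^ 2).
  { unfold G, envelope_conic; cbn [qxx]; rewrite G1, G2.
    f_equal; f_equal.
    transitivity (1 + 4 * k - 2 * fst be + 4 * k ^ 2 - 4 * k * fst be
        + (fst be ^ 2 + snd be ^ 2) - fst al ^ 2); [ring | rewrite Hbe; ring]. }
  assert (Eyy : qyy G = 4 * (- 4 * k + 4 * k ^ 2 - 4 * k * fst be + 2 * fst be
                - chord_mid a b Q + fst al ^ 2) / b ^ 2).
  { unfold G, envelope_conic; cbn [qyy]; rewrite G1, G2.
    f_equal; f_equal.
    transitivity (1 - 4 * k + 2 * fst be + 4 * k ^ 2 - 4 * k * fst be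
        + (fst be ^ 2 + snd be ^ 2) - snd al ^ 2); [ring | rewrite Hbe; ring]. }
  split; [| split; [ring | split]].
  - unfold s; apply Rmult_integral_contrapositive; split.
    + apply Rmult_integral_contrapositive; split; [lra | exact Hdet].
    + apply Rinv_neq_0_compat; repeat (apply Rmult_integral_contrapositive; split);
      first [lra | exact H33].
  - unfold G, envelope_conic; cbn [qxy]; rewrite G2.
    unfold s, al, be, foci_sum, foci_prod, conic_det; cbn [fst snd].
    field_simplify_eq; [| repeat split; first [lra | assumption]].
    unfold adj12, adj13, adj23, adj33; ring.
  - rewrite Exx, Eyy.
    unfold s, k, axis_ratio, al, be, foci_sum, foci_prod, chord_mid, conic_det; cbn [fst snd].
    field_simplify_eq; [| repeat split; first [lra | assumption]].
    unfold adj11, adj22, adj12, adj13, adj23, adj33; ring.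
Qed.

Theorem proposition4 (a b : R) (Ec : conic)
    (ha : 0 < a) (hb : 0 < b) (hab : a <> b)
    (hEc : is_ellipse Ec) (hnested : nested Ec a b)
    (hporism : admits_porism (std_ellipse a b) Ec) :
  (forall P : point, on_conic (std_ellipse a b) P ->
     line_like (locus_gP (std_ellipse a b) Ec P)) /\
  exists Gamma : conic,
    nondegenerate Gamma /\
    is_envelope
      (fun t L =>
         punctured_line L (locus_gP (std_ellipse a b) Ec (ellipse_point a b t)))
      (on_conic Gamma) /\
    concentric Gamma Ec /\
    axis_aligned Gamma Ec /\
    (axis_aligned Gamma (std_ellipse a b) <->
     axis_aligned Ec (std_ellipse a b)).
Proof.
  pose proof hEc as (HQ & _); change (0 < adj33 Ec) in HQ.
  set (al := foci_sum a b Ec).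
  set (ga := gamma a b (foci_prod a b Ec)).
  assert (L : forall p, on_unit p -> gP_dir al ga p <> 0%C /\
    punctured_line (locus_line a b al ga p)
      (locus_gP (std_ellipse a b) Ec (stretch a b p)))
    by (intros p Hp; apply locus_punctured; assumption).
  split.
  - intros P HP.
    exists (locus_line a b al ga (squash a b P)).
    rewrite <- (stretch_squash a b P) in HP |- * by lra.
    rewrite on_std_ellipse in HP by lra.
    rewrite stretch_squash by lra; rewrite <- (stretch_squash a b P) at 2 by lra.
    apply L; exact HP.
  - assert (HK : env_disc al ga <> 0).
    { apply env_disc_neq_0; [apply foci_sum_small; assumption|].
      intros p Hp; apply L; exact Hp. }
    destruct (envelope_pencil a b Ec ha hb hab hEc
      (closing_relation a b Ec ha hb HQ hnested hporism))
      as (s & t & Hs & E1 & E2 & E3).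
    fold al in E1, E2, E3; fold ga in E1, E2, E3.
    assert (AX : forall D, axis_direction (envelope_conic a b al ga) D
                           <-> axis_direction Ec D)
      by (intros D; apply (axis_direction_pencil _ _ s t); assumption).
    exists (envelope_conic a b al ga); split; [| split; [| split; [| split]]].
    + apply envelope_conic_nondegenerate; try assumption; lra.
    + apply is_envelope_conic; try assumption.
      intros t'; apply (L (cos t', sin t')); apply unit_cis.
    + exists (center Ec); split; [| apply is_center_center; exact HQ].
      replace (center Ec) with (a * fst al / 2, b * snd al / 2).
      * apply envelope_conic_center; try assumption; lra.
      * unfold center, al, foci_sum; cbn [fst snd].
        apply C_eq; cbn [fst snd]; field; lra.
    + destruct (axis_direction_exists Ec) as [D HD].
      exists D; split; [apply AX |]; exact HD.
    + split; intros (D & H1 & H2); exists D; split; try exact H2; apply AX; exact H1.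
Qed.
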